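(* Let $n\ge 3$. Choose a set $\mathcal{C}$ of circuits of $K_n$ containing exactly one circuit traversing each standard cycle of $K_n$ (of any length $\ge 3$). Then the elements $\{L_C, L'_C\}_{C\in\mathcal{C}}$ of $E_2$ are linearly independent over $\mathbb{Q}$. Consequently, for every $q\ge1$, \[\dim_{\mathbb{Q}} E_3^{1,q}\ \ge\ 2\binom{n}{q+2}\,q!.\]
   Context: Let $E$ be a complex elliptic curve, $x,y$ a basis of $H^1(E;\mathbb{Q})$ with $xy$ generating $H^2(E;\mathbb{Q})$, and $C(n)\subset E^n$ the configuration space of $n$ distinct ordered points of $E$. Let $E_2=E_2^{\bullet,\bullet}$ (with differential $d_2$) be the second page of the rational Leray spectral sequence of $C(n)\hookrightarrow E^n$: the quotient of the free graded-commutative algebra (for total degree) over $\mathbb{Q}$ on $x_i,y_i$ ($1\le i\le n$), bidegree $(1,0)$, and $\omega_{ij}=\omega_{ji}$ ($i\ne j$), bidegree $(0,1)$, by the relations $(x_i-x_j)\omega_{ij}=0$, $(y_i-y_j)\omega_{ij}=0$, $\omega_{ij}\omega_{jk}+\omega_{jk}\omega_{ki}+\omega_{ki}\omega_{ij}=0$ (distinct $i,j,k$); $d_2$ is the derivation of bidegree $(2,-1)$ with $d_2x_i=d_2y_i=0$, $d_2\omega_{ij}=(x_i-x_j)(y_i-y_j)$. The third page is $E_3^{p,q}=\ker(d_2:E_2^{p,q}\to E_2^{p+2,q-1})/\operatorname{im}(d_2:E_2^{p-2,q+1}\to E_2^{p,q})$. A circuit of length $k\ge3$ in $K_n$ is a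 sequence $C=(c_1,\dots,c_k)$ of oriented edges (source $s(c)$, target $t(c)$) with $t(c_i)=s(c_{i+1})$, $t(c_k)=s(c_1)$ and pairwise distinct $s(c_i)$; it traverses the (unoriented) simple cycle formed by its edges. A cycle (or circuit) is standard if its two greatest vertices are adjacent in it. With $\omega_c=\omega_{s(c),t(c)}$ and $\omega_{C\setminus\{c_i,c_j\}}$ the product of the $\omega_{c_m}$, $m\notin\{i,j\}$, in increasing order of $m$, set $L_C=\sum_{1\le i<j\le k}(-1)^{i+j}(x_{t(c_i)}-x_{s(c_i)})\omega_{C\setminus\{c_i,c_j\}}$ and $L'_C=\sum_{1\le i<j\le k}(-1)^{i+j}(y_{t(c_i)}-y_{s(c_i)})\omega_{C\setminus\{c_i,c_j\}}$, elements of $E_2^{1,k-2}$ lying in $\ker d_2$. *)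

(* Defs.v *)
From HB Require Import structures.
From mathcomp Require Import all_boot all_order all_algebra.
Set Implicit Arguments. Unset Strict Implicit. Unset Printing Implicit Defensive.
Import Order.TTheory GRing.Theory Num.Theory.
Local Open Scope ring_scope.

Section E2Page.
Variable n : nat.

(* unordered pairs {i,j}, i <> j, encoded as (i,j) with i < j *)
Definition Pair := {p : 'I_n * 'I_n | (p.1 < p.2)%N}.

(* generators: inl (inl i) = x_i, inl (inr i) = y_i, inr {i<j} = omega_ij *)
Definition gen := (('I_n + 'I_n) + Pair)%type.

Definition isxy (g : gen) : bool := if g is inl _ then true else false.

(* The free graded-commutative Q-algebra on generators all of total degree 1
   is the exterior algebra; element = coefficients on the monomials e_S,
   S a set of generators, e_S = product of its generators in increasing
   order of enum_rank. *)
Definition V := {ffun {set gen} -> rat^o}.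

Definition mono (S : {set gen}) : V := [ffun U => (U == S)%:R].

Definition sgn (S T : {set gen}) : rat :=
  (-1) ^+ #|[set st in setX S T | (enum_rank st.2 < enum_rank st.1)%N]|.

Definition mmul (S T : {set gen}) : V :=
  if [disjoint S & T] then sgn S T *: mono (S :|: T) else 0.

Definition mul (f g : V) : V :=
  \sum_(A : {set gen}) \sum_(B : {set gen}) (f A * g B) *: mmul A B.

Definition one : V := mono set0.
Definition prodl (s : seq V) : V := foldr mul one s.

Definition genv (g : gen) : V := mono [set g].
Definition xg (i : 'I_n) : V := genv (inl (inl i)).
Definition yg (i : 'I_n) : V := genv (inl (inr i)).

Definition uedge (e : 'I_n * 'I_n) : 'I_n * 'I_n :=
  if (e.1 < e.2)%N then e else (e.2, e.1).

Definition omega (i j : 'I_n) : V :=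
  match (insub (uedge (i, j)) : option Pair) with
  | Some p => genv (inr p)
  | None => 0
  end.

Definition relsX : seq V :=
  [seq mul (xg ij.1 - xg ij.2) (omega ij.1 ij.2)
  | ij <- enum [set ij : 'I_n * 'I_n | ij.1 != ij.2]].
Definition relsY : seq V :=
  [seq mul (yg ij.1 - yg ij.2) (omega ij.1 ij.2)
  | ij <- enum [set ij : 'I_n * 'I_n | ij.1 != ij.2]].
Definition arnold (t : 'I_n * 'I_n * 'I_n) : V :=
  let: (i, j, k) := t in
  mul (omega i j) (omega j k) + mul (omega j k) (omega k i)
  + mul (omega k i) (omega i j).
Definition relsA : seq V :=
  [seq arnold t | t <- enum [set t : 'I_n * 'I_n * 'I_n |
     [&& t.1.1 != t.1.2, t.1.2 != t.2 & t.2 != t.1.1]]].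
Definition rels : seq V := relsX ++ relsY ++ relsA.

Definition Iideal : {vspace V} :=
  <<[seq mul (mul (mono A) rT.1) (mono rT.2)
    | A <- enum {set gen},
      rT <- [seq (r, T) | r <- rels, T <- enum {set gen}]]>>%VS.

Definition degp (S : {set gen}) : nat := #|[set g in S | isxy g]|.
Definition degq (S : {set gen}) : nat := #|[set g in S | ~~ isxy g]|.

Definition comp (p q : nat) : {vspace V} :=
  <<[seq mono A | A <- enum {set gen} & (degp A == p) && (degq A == q)]>>%VS.

Definition dgen (g : gen) : V :=
  match g with
  | inr p => mul (xg (val p).1 - xg (val p).2) (yg (val p).1 - yg (val p).2)
  | inl _ => 0
  end.

(* graded derivation (total degree 1) on a monomial g_1 ... g_k *)
Definition d2mono (S : {set gen}) : V :=
  \sum_(g in S)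
    let pre := [seq h <- enum S | (enum_rank h < enum_rank g)%N] in
    let post := [seq h <- enum S | (enum_rank g < enum_rank h)%N] in
    (-1) ^+ size pre *:
      mul (mul (prodl (map genv pre)) (dgen g)) (prodl (map genv post)).

Definition d2fun (f : V) : V := \sum_(A : {set gen}) f A *: d2mono A.
Definition d2 : 'End(V) := linfun d2fun.

(* dim_Q E_3^{p,q} = dim ker(d2 : E_2^{p,q} -> E_2^{p+2,q-1})
                    - dim im(d2 : E_2^{p-2,q+1} -> E_2^{p,q}),
   computed on representatives in the exterior algebra. *)
Definition E3dim (p q : nat) : nat :=
  let Z := (comp p q :&: (d2 @^-1: Iideal))%VS in
  let lower := if (2 <= p)%N then comp (p - 2) q.+1 else 0%VS in
  let B := ((comp p q :&: Iideal) + (d2 @: lower))%VS in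
  (\dim Z - \dim B)%N.

Definition circuit (c : seq 'I_n) : bool := uniq c && (3 <= size c)%N.
Definition cedges (c : seq 'I_n) : seq ('I_n * 'I_n) := zip c (rot 1 c).
Definition edgeset (c : seq 'I_n) : {set 'I_n * 'I_n} :=
  [set uedge e | e in cedges c].
(* the two greatest vertices are adjacent *)
Definition standard (c : seq 'I_n) : bool :=
  [exists e in edgeset c,
    all (fun v => [|| v == e.1, v == e.2 | (v < e.1)%N && (v < e.2)%N]) c].

Definition Lgen (z : 'I_n -> V) (c : seq 'I_n) : V :=
  let ies := zip (iota 0 (size (cedges c))) (cedges c) in
  \sum_(a <- ies) \sum_(b <- ies | (a.1 < b.1)%N)
    (-1) ^+ (a.1 + b.1) *:
      mul (z a.2.2 - z a.2.1)
          (prodl [seq omega e.2.1 e.2.2 | e <- ies & (e.1 != a.1) && (e.1 != b.1)]).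
Definition LC := Lgen xg.
Definition LC' := Lgen yg.

Definition std_reps (cs : seq (seq 'I_n)) : Prop :=
  (forall c, c \in cs -> circuit c && standard c) /\
  (forall d, circuit d -> standard d ->
     count (fun c => edgeset c == edgeset d) cs = 1%N).

End E2Page.

(* Main.v *)
(* E_2 is the exterior algebra on the x_i, y_i, w_ij modulo an ideal I.

   Independence.  For a > m > all of v_1, ..., v_r let B = (m, v_1, ..., v_r), and consider the algebra
   map into an exterior algebra sending x_a to itself, every other x_i and y_i to 0, and w_ij to the
   generator x_k, where k is whichever of i, j comes later in B (to 0 unless i and j both lie in B).
   It kills I; on the Arnold relation of i, j, k with k last it gives jk + kk + kj = 0.  The image of
   L_C retains only the term in which the two edges at a are deleted, and its coefficient at
   x_a x_{v_1} ... x_{v_r} is nonzero only if the remaining path has pairwise distinct later endpoints.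
   For a standard cycle, whose path starts at m, this forces the path to be m, v_1, ..., v_r.  So each
   standard cycle has a functional vanishing on I and on all the other elements.

   L_C lies in ker d_2.  For a list s of edges let P, Q, L be the sums of products with 0, 1 and 2 edges
   removed (L weighted by the increments X of x), and x, y the total increments.  Modulo I one has
   xP = yP = 0, dP = xyQ, dQ = xZ - yL and dL = xM + yN for suitable Z, M, N, by induction on s.
   For a circuit x = y = 0.  As the Arnold relation is Q of a triangle, this also gives d_2 I <= I, which
   the dimension count needs; that count then compares with the C(n, q+2) q! standard cycles of
   length q+2. *)

Require Import Defs.
From HB Require Import structures.
From mathcomp Require Import all_boot all_order all_algebra ring.
Set Implicit Arguments. Unset Strict Implicit. Unset Printing Implicit Defensive.
(* [all_algebra] shadows [mul] of [Defs]. *)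
Import GRing.Theory Defs.
Local Open Scope ring_scope.

(** * The exterior algebra as a ring *)

Section MulLaws.
Variable n : nat.
Implicit Types (f g h : V n) (A B C : {set gen n}) (x : gen n).

Lemma mulDl_subproof : left_distributive (@mul n) +%R.
Proof.
move=> f g h; rewrite /mul -big_split /=; apply: eq_bigr => A _.
rewrite -big_split /=; apply: eq_bigr => B _.
by rewrite ffunE mulrDl scalerDl.
Qed.

Lemma mulDr_subproof : right_distributive (@mul n) +%R.
Proof.
move=> f g h; rewrite /mul -big_split /=; apply: eq_bigr => A _.
rewrite -big_split /=; apply: eq_bigr => B _.
by rewrite ffunE mulrDr scalerDl.
Qed.

Lemma mulZl_subproof (a : rat) f g : mul (a *: f) g = a *: mul f g.
Proof.
rewrite /mul scaler_sumr; apply: eq_bigr => A _.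
rewrite scaler_sumr; apply: eq_bigr => B _.
by rewrite ffunE scalerA -mulrA.
Qed.

Lemma mulZr_subproof (a : rat) f g : mul f (a *: g) = a *: mul f g.
Proof.
rewrite /mul scaler_sumr; apply: eq_bigr => A _.
rewrite scaler_sumr; apply: eq_bigr => B _.
by rewrite ffunE scalerA mulrCA.
Qed.

Lemma mul0_subproof f : mul 0 f = 0.
Proof. by rewrite -(scale0r (0 : V n)) mulZl_subproof !scale0r. Qed.

Lemma mulr0_subproof f : mul f 0 = 0.
Proof. by rewrite -(scale0r (0 : V n)) mulZr_subproof !scale0r. Qed.

Lemma sum_mono f : f = \sum_A f A *: mono A.
Proof.
apply/ffunP => U; rewrite sum_ffunE (bigD1 U) //= big1 ?addr0; last first.
  by move=> A /negPf AU; rewrite !ffunE eq_sym AU /GRing.scale /= mulr0.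
by rewrite !ffunE eqxx /GRing.scale /= mulr1.
Qed.

Lemma mul_mono A B : mul (mono A) (mono B) = mmul A B.
Proof.
rewrite /mul (bigD1 A) //= [X in _ + X]big1 ?addr0; last first.
  move=> C /negPf CA; apply: big1 => D _.
  by rewrite ffunE CA mul0r scale0r.
rewrite (bigD1 B) //= big1 ?addr0; last first.
  by move=> D /negPf DB; rewrite !ffunE DB mulr0 scale0r.
by rewrite !ffunE !eqxx mulr1 scale1r.
Qed.

Local Opaque mul mono.

Lemma sgnUl A B C : [disjoint A & B] -> sgn (A :|: B) C = sgn A C * sgn B C.
Proof.
move=> dAB; rewrite /sgn -exprD; congr (_ ^+ _).
rewrite -cardsUI [X in (_ + X)%N](_ : _ = 0%N) ?addn0; last first.
  apply/eqP; rewrite cards_eq0; apply/eqP/setP => -[u v].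
  rewrite !inE /=; case: (boolP (u \in A)) => //= uA.
  by rewrite (disjointFr dAB uA) ?andbF.
by apply: eq_card => -[u v]; rewrite !inE /= -andb_orl -andb_orl.
Qed.

Lemma sgnUr A B C : [disjoint B & C] -> sgn A (B :|: C) = sgn A B * sgn A C.
Proof.
move=> dBC; rewrite /sgn -exprD; congr (_ ^+ _).
rewrite -cardsUI [X in (_ + X)%N](_ : _ = 0%N) ?addn0; last first.
  apply/eqP; rewrite cards_eq0; apply/eqP/setP => -[u v].
  rewrite !inE /=; case: (boolP (v \in B)) => vB; last by rewrite andbF.
  by rewrite (disjointFr dBC vB) !andbF.
by apply: eq_card => -[u v]; rewrite !inE /= -andb_orl -andb_orr.
Qed.

Lemma mmulT A B : [disjoint A & B] -> mmul A B = sgn A B *: mono (A :|: B).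
Proof. by rewrite /mmul => ->. Qed.

Lemma mmulF A B : ~~ [disjoint A & B] -> mmul A B = 0.
Proof. by rewrite /mmul => /negPf ->. Qed.

Local Opaque mmul.

(** Both sides vanish unless [A], [B], [C] are pairwise disjoint; in that case [sgnUl] and [sgnUr]
    turn either sign into [sgn A B * sgn A C * sgn B C]. *)
Lemma mul_monoA A B C :
  mul (mono A) (mul (mono B) (mono C)) = mul (mul (mono A) (mono B)) (mono C).
Proof.
have dUr (X Y Z : {set gen n}) : [disjoint X & Y :|: Z] = [disjoint X & Y] && [disjoint X & Z].
  by rewrite -!setI_eq0 setIUr setU_eq0.
have dUl (X Y Z : {set gen n}) : [disjoint X :|: Y & Z] = [disjoint X & Z] && [disjoint Y & Z].
  by rewrite -!setI_eq0 setIUl setU_eq0.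
rewrite !mul_mono.
have [dBC|dBC] := boolP [disjoint B & C]; last first.
  rewrite (mmulF dBC) mulr0_subproof.
  have [dAB|dAB] := boolP [disjoint A & B]; last by rewrite mmulF // mul0_subproof.
  by rewrite mmulT // mulZl_subproof mul_mono mmulF ?scaler0 // dUl (negPf dBC) andbF.
have [dAB|dAB] := boolP [disjoint A & B]; last first.
  rewrite (mmulF dAB) mul0_subproof mmulT // mulZr_subproof mul_mono mmulF ?scaler0 //.
  by rewrite dUr (negPf dAB).
rewrite mmulT // [mmul A B]mmulT // mulZl_subproof mulZr_subproof !mul_mono.
have [dAC|dAC] := boolP [disjoint A & C]; last first.
  by rewrite !mmulF ?scaler0 // ?dUl ?dUr (negPf dAC) ?andbF.
have dA : [disjoint A & B :|: C] by rewrite dUr dAB.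
have dC : [disjoint A :|: B & C] by rewrite dUl dAC.
rewrite (mmulT dA) (mmulT dC) !scalerA (sgnUl _ dAB) (sgnUr _ dBC) setUA.
congr (_ *: _); exact: etrans (mulrC _ _) (esym (mulrA _ _ _)).
Qed.

Lemma mono_ind (P : V n -> Prop) : P 0 ->
  (forall a A f, P f -> P (a *: mono A + f)) -> forall f, P f.
Proof. by move=> P0 PD f; rewrite (sum_mono f); elim/big_rec: _ => // A g _; apply: PD. Qed.

Lemma mulA_subproof : associative (@mul n).
Proof.
elim/mono_ind => [|a A f IHf] g h; first by rewrite !mul0_subproof.
rewrite !mulDl_subproof IHf !mulZl_subproof; congr (_ *: _ + _).
elim/mono_ind: g h => [|b B g IHg] h; first by rewrite !(mul0_subproof, mulr0_subproof).
rewrite !(mulDl_subproof, mulDr_subproof) IHg !(mulZl_subproof, mulZr_subproof).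
congr (_ *: _ + _).
elim/mono_ind: h => [|c C h IHh]; first by rewrite !mulr0_subproof.
by rewrite !mulDr_subproof IHh !mulZr_subproof mul_monoA.
Qed.

Lemma sgn0l A : sgn set0 A = 1.
Proof.
by rewrite /sgn eq_card0 // => -[u v]; rewrite !inE.
Qed.

Lemma sgn0r A : sgn A set0 = 1.
Proof.
by rewrite /sgn eq_card0 // => -[u v]; rewrite !inE andbF.
Qed.

Lemma mul1_subproof : left_id (@one n) (@mul n).
Proof.
elim/mono_ind => [|a A f IHf]; first exact: mulr0_subproof.
rewrite mulDr_subproof IHf mulZr_subproof mul_mono mmulT -?setI_eq0 ?set0I //.
by rewrite sgn0l scale1r set0U.
Qed.

Lemma mulr1_subproof : right_id (@one n) (@mul n).
Proof.
elim/mono_ind => [|a A f IHf]; first exact: mul0_subproof.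
rewrite mulDl_subproof IHf mulZl_subproof mul_mono mmulT -?setI_eq0 ?setI0 //.
by rewrite sgn0r scale1r setU0.
Qed.

Lemma one_neq0_subproof : one n != 0.
Proof.
by apply/eqP => /ffunP/(_ set0)/eqP; rewrite !ffunE eqxx.
Qed.

End MulLaws.

(** From here on [mul] is the ring product of [V n], so that the generic theory of rings, algebras
    and vector spaces applies to the exterior algebra. *)
HB.instance Definition _ n := GRing.Lmodule.copy (V n) {ffun {set gen n} -> rat^o}.
HB.instance Definition _ n := GRing.Zmodule_isNzRing.Build (V n)
  (@mulA_subproof n) (@mul1_subproof n) (@mulr1_subproof n)
  (@mulDl_subproof n) (@mulDr_subproof n) (@one_neq0_subproof n).
HB.instance Definition _ n := GRing.Lmodule_isLalgebra.Build rat (V n)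
  (fun a f g => esym (mulZl_subproof a f g)).
HB.instance Definition _ n := GRing.Lalgebra_isAlgebra.Build rat (V n)
  (fun a f g => esym (mulZr_subproof a f g)).
HB.instance Definition _ n := Vector.copy (V n) {ffun {set gen n} -> rat^o}.

(** * Products of anticommuting elements *)

Section OddFamilies.
Variables (R : nzRingType) (T : eqType).
Implicit Types (w z : T -> R) (s t : seq T).

Definition odd_family w :=
  (forall e, w e * w e = 0) /\ (forall e f, w e * w f = - (w f * w e)).

Definition prodw w s : R := \prod_(e <- s) w e.

(* With s = (e_0, ..., e_k) and P(i, ...) the product of the w e in order with e_i, ... omitted,
   [deletion w s] is the sum over j of (-1)^j P(j), and [deletion2 w z s] the sum over i < j of
   (-1)^(i+j) z(e_i) P(i, j) as soon as w and z anticommute. *)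
Fixpoint deletion w s : R :=
  if s is e :: s' then prodw w s' - w e * deletion w s' else 0.

Fixpoint deletion2 w z s : R :=
  if s is e :: s' then - (z e * deletion w s') - w e * deletion2 w z s' else 0.

Lemma prodw_nil w : prodw w [::] = 1.
Proof. exact: big_nil. Qed.

Lemma prodw_cons w e s : prodw w (e :: s) = w e * prodw w s.
Proof. exact: big_cons. Qed.

Lemma prodw_cat w s t : prodw w (s ++ t) = prodw w s * prodw w t.
Proof. exact: big_cat. Qed.

Lemma eq_in_prodw w w' s : {in s, w =1 w'} -> prodw w s = prodw w' s.
Proof. exact: eq_big_seq. Qed.

Lemma prodw0 w s e : e \in s -> w e = 0 -> prodw w s = 0.
Proof.
elim: s => //= f s IH; rewrite inE prodw_cons => /predU1P[-> -> | es we].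
  by rewrite mul0r.
by rewrite IH // mulr0.
Qed.

Lemma prodwC w s e : odd_family w ->
  w e * prodw w s = (-1) ^+ odd (size s) * (prodw w s * w e).
Proof.
case=> _ wC; rewrite mulr_sign; elim: s => [|f s IH].
  by rewrite prodw_nil mul1r mulr1.
rewrite !prodw_cons -mulrA mulrA wC mulNr -mulrA IH /=.
by case: (odd _); rewrite /= ?mulrN ?opprK.
Qed.

(** A repeated factor is moved next to its other copy by [prodwC], where the square is zero. *)
Lemma prodw_nonuniq w s : odd_family w -> ~~ uniq s -> prodw w s = 0.
Proof.
move=> ow; elim: s => //= e s IH; rewrite negb_and negbK prodw_cons.
case/orP=> [es|/IH ->]; last by rewrite mulr0.
case/splitPr: es => s1 s2; rewrite prodw_cat prodw_cons mulrA prodwC // mulr_sign.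
by case: ifP => _; rewrite ?mulNr -!mulrA [w e * (w e * _)]mulrA ow.1 mul0r mulr0 ?oppr0.
Qed.

End OddFamilies.

(** The sign [b] is chosen before the ring [R] and the family [w], so it depends only on the two
    lists. Products over different rings, such as [V n] and the matrices over it, are thus reordered
    with the same sign. *)
Lemma prodw_perm (T : eqType) (s t : seq T) : perm_eq s t ->
  exists b : bool, forall (R : nzRingType) (w : T -> R), odd_family w ->
    prodw w s = (-1) ^+ b * prodw w t.
Proof.
elim: s t => [|e s IH] t.
  rewrite perm_sym => /perm_nilP ->; exists false => R w _.
  by rewrite mul1r.
move=> pst; have et : e \in t by rewrite -(perm_mem pst) mem_head.
case/splitPr: et pst => t1 t2 pst.
have [|b Hb] := IH (t1 ++ t2).
  by rewrite -(perm_cons e) (perm_trans pst) // -cat1s perm_catCA.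
exists (odd (size t1) (+) b) => R w ow.
rewrite prodw_cons (Hb R w ow) !prodw_cat prodw_cons !mulr_sign !mulrA.
rewrite [prodw w t1 * w e](_ : _ = (-1) ^+ odd (size t1) * (w e * prodw w t1)).
  by rewrite mulr_sign; case: (odd _); case: (b); rewrite /= ?mulrN ?mulNr ?mulrA ?opprK.
by rewrite prodwC // !mulr_sign; case: (odd _); rewrite ?opprK.
Qed.

Section Deletions.
Variables (R : nzRingType) (T : eqType).
Implicit Types (w z : T -> R) (s t : seq T).

Lemma deletion2_eq0 w z s : {in s, forall e, z e = 0} -> deletion2 w z s = 0.
Proof.
elim: s => //= e s IH zs; rewrite zs ?mem_head // IH ?mul0r ?mulr0 ?subrr ?oppr0 ?addr0 //.
by move=> f fs; apply: zs; rewrite inE fs orbT.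
Qed.

Variables (Z : pred T) (w z : T -> R).
Hypothesis wZ : forall e, Z e -> w e = 0.

Let prodw_Z s : has Z s -> prodw w s = 0.
Proof. by case/hasP=> e es /wZ; apply: prodw0. Qed.

(** Every term that retains the entry in [Z] vanishes, so only the deletion of that entry
    survives. *)
Let deletion_Z s : count Z s = 1%N ->
  exists b : bool, deletion w s = (-1) ^+ b * prodw w (filter (predC Z) s).
Proof.
elim: s => //= e s IH; have [Ze|nZe] /= := boolP (Z e).
  move=> [/eqP]; rewrite -leqn0 leqNgt -has_count => nZs; exists false.
  rewrite wZ // mul0r subr0 mul1r; congr prodw; symmetry; apply/all_filterP.
  by rewrite all_predC.
rewrite add0n => cs; have [b ->] := IH cs; exists (~~ b).
have hZ : has Z s by rewrite has_count (cs : count Z s = 1%N).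
rewrite (prodw_Z hZ) add0r prodw_cons !mulr_sign.
by case: b; rewrite /= ?mulrN ?opprK.
Qed.

Let deletion_Z2 s : count Z s = 2%N -> deletion w s = 0.
Proof.
elim: s => //= e s IH; have [Ze|nZe] /= := boolP (Z e).
  move=> [cs0]; have cs : count Z s = 1%N := cs0.
  by rewrite wZ // mul0r prodw_Z ?subr0 // has_count cs.
move=> cs0; have cs : count Z s = 2%N := cs0.
have hZ : has Z s by rewrite has_count cs.
by rewrite (prodw_Z hZ) IH // mulr0 subr0.
Qed.

Hypothesis wz : forall e f, w e * z f = - (z f * w e).

(** Only the term deleting both entries in [Z] survives, weighted by [z] at the earlier one. This
    isolates the two edges of a circuit at a given vertex. *)
Lemma deletion2_two_zeros s : count Z s = 2%N ->
  exists (b : bool) (e : T), [/\ e \in s, Z e &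
    deletion2 w z s = (-1) ^+ b * (z e * prodw w (filter (predC Z) s))].
Proof.
elim: s => //= e s IH; have [Ze|nZe] /= := boolP (Z e).
  move=> [/deletion_Z[b ->]]; exists (~~ b), e; split; rewrite ?mem_head //.
  by rewrite wZ // mul0r subr0 !mulr_sign; case: b; rewrite /= ?mulrN ?opprK.
move=> cs0; have cs : count Z s = 2%N := cs0; have [b [f [fs Zf ->]]] := IH cs.
exists b, f; split; rewrite ?inE ?fs ?orbT //.
rewrite (deletion_Z2 cs) mulr0 oppr0 add0r prodw_cons !mulr_sign.
by case: b; rewrite /= ?mulrN ?opprK [w e * (z f * _)]mulrA wz mulNr mulrA ?opprK.
Qed.

End Deletions.

(** * Monomials as ordered products of generators *)

Section Monomials.
Variable n : nat.
Implicit Types (f g : V n) (A B : {set gen n}) (x y : gen n) (s t : seq (gen n)).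

Lemma mulE f g : mul f g = f * g.
Proof. by []. Qed.

Lemma prodlE (s : seq (V n)) : prodl s = \prod_(f <- s) f.
Proof. by elim: s => [|f s IH] /=; rewrite ?big_nil // big_cons -IH. Qed.

Lemma mul_disjoint_mono A B : [disjoint A & B] ->
  mono A * mono B = sgn A B *: mono (A :|: B).
Proof. by move=> dAB; rewrite -(mmulT dAB) -mul_mono. Qed.

Lemma mul_meeting_mono A B : ~~ [disjoint A & B] -> mono A * mono B = 0.
Proof. by move=> dAB; rewrite -(mmulF dAB) -mul_mono. Qed.

Definition rank_lt x y := (enum_rank x < enum_rank y)%N.

Lemma rank_lt_trans : transitive rank_lt.
Proof. by move=> y x z; apply: ltn_trans. Qed.

(** Lets [mono A] be the product of the generators along [enum A], with no sign. *)
Lemma sorted_enum A : sorted rank_lt (enum A).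
Proof.
rewrite /enum_mem sorted_filter //; first exact: rank_lt_trans.
rewrite -enumT; case E: (enum {: gen n}) => [|x0 r] //; rewrite -E.
have rank_nth i : (i < size (enum {: gen n}))%N ->
    enum_rank (nth x0 (enum {: gen n}) i) = i :> nat.
  rewrite -cardE => lti; rewrite (_ : nth _ _ _ = enum_val (Ordinal lti)).
    by rewrite enum_valK.
  by rewrite (enum_val_nth x0).
apply/(sortedP x0) => i lti; rewrite /rank_lt !rank_nth //; exact: ltnW.
Qed.

Lemma genv_odd : odd_family (@genv n).
Proof.
split=> [x|x y].
  by apply: mul_meeting_mono; rewrite -setI_eq0 setIid -cards_eq0 cards1.
have [->|neq_xy] := eqVneq x y.
  rewrite mul_meeting_mono ?oppr0 //.
  by rewrite -setI_eq0 setIid -cards_eq0 cards1.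
rewrite !mul_disjoint_mono ?disjoints1 ?inE // 1?eq_sym //.
rewrite /sgn.
have sgn2 u v : [set st in setX [set u] [set v] | (enum_rank st.2 < enum_rank st.1)%N]
   = if rank_lt v u then [set (u, v)] else set0.
  apply/setP => -[u' v']; rewrite !inE /=.
  case: eqP => [->|nu]; case: eqP => [->|nv] //=; case: ifP => uv; rewrite !inE //.
  - by rewrite eqxx.
  - by rewrite xpair_eqE eqxx; apply/esym/eqP.
  - by rewrite xpair_eqE eqxx andbT; apply/esym/eqP.
  - by rewrite xpair_eqE andbC; case: eqP.
rewrite !sgn2 setUC /rank_lt; case: ltngtP => [_|_|/val_inj/enum_rank_inj Exy].
- by rewrite cards1 cards0 expr1 expr0 scale1r scaleN1r.
- by rewrite cards1 cards0 expr1 expr0 scale1r scaleN1r opprK.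
- by rewrite Exy eqxx in neq_xy.
Qed.

Lemma prodw_genv_sorted s : sorted rank_lt s -> prodw (@genv n) s = mono [set x in s].
Proof.
elim: s => [_|x s IH].
  rewrite prodw_nil; congr mono; apply/setP => x; by rewrite !inE.
rewrite /= path_sortedE; last exact: rank_lt_trans.
case/andP => /allP xs ss; rewrite prodw_cons (IH ss).
have xNs : x \notin s by apply/negP => /xs; rewrite /rank_lt ltnn.
rewrite mul_disjoint_mono ?disjoints1 ?inE //.
rewrite /sgn eq_card0 ?scale1r; last first.
  move=> [u v]; rewrite !inE /=; apply/negP => /andP[/andP[/eqP-> /xs]].
  by rewrite /rank_lt => xv /(ltn_trans xv); rewrite ltnn.
by congr mono; apply/setP => y; rewrite !inE.
Qed.
End Monomials.

(** * Odd elements and algebra maps out of the exterior algebra *)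

Section Extensions.
Variable n : nat.
Implicit Types (f g : V n) (A B : {set gen n}) (x y : gen n) (s t : seq (gen n)).

Lemma mono_prodw A : mono A = prodw (@genv n) (enum A).
Proof.
by rewrite prodw_genv_sorted ?sorted_enum //; congr mono; apply/setP => x; rewrite inE mem_enum.
Qed.

Lemma prodw_genv_uniq s : uniq s ->
  exists b : bool, prodw (@genv n) s = (-1) ^+ b * mono [set x in s].
Proof.
move=> us; have [|b Hb] := @prodw_perm _ s (enum [set x in s]).
  by apply: uniq_perm => // [|x]; rewrite ?enum_uniq // mem_enum inE.
by exists b; rewrite (Hb _ _ (@genv_odd n)) -mono_prodw.
Qed.

Lemma prodw_enum_perm s : uniq s -> perm_eq s (enum [set x in s]).
Proof. by move=> us; apply: uniq_perm => // [|x]; rewrite ?enum_uniq // mem_enum inE. Qed.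

Lemma span_ind (X : seq (V n)) (P : V n -> Prop) : P 0 ->
  (forall a v f, v \in X -> P f -> P (a *: v + f)) ->
  forall f, f \in <<X>>%VS -> P f.
Proof.
move=> P0 PD f fX; rewrite (coord_span (X := in_tuple X) fX); elim/big_rec: _ => // i g _; apply: PD.
exact: mem_nth.
Qed.

Definition odd1 : {vspace V n} := <<codom (@genv n)>>%VS.

Lemma genv_odd1 x : genv x \in odd1.
Proof. by apply: memv_span; exact: codom_f. Qed.

Lemma odd1_ind (P : V n -> Prop) : P 0 ->
  (forall a x f, P f -> P (a *: genv x + f)) -> forall f, f \in odd1 -> P f.
Proof.
by move=> P0 PD; apply: span_ind => // a v f /codomP[x ->]; apply: PD.
Qed.

Lemma genv_odd1C x f : f \in odd1 -> genv x * f = - (f * genv x).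
Proof.
elim/odd1_ind: f / => [|a y f IHf]; first by rewrite mul0r mulr0 oppr0.
by rewrite mulrDl mulrDr opprD IHf -scalerAl -scalerAr (genv_odd n).2 scalerN.
Qed.

Lemma odd1C f g : f \in odd1 -> g \in odd1 -> f * g = - (g * f).
Proof.
elim/odd1_ind: f / => [|a x f IHf] gO; first by rewrite mul0r mulr0 oppr0.
by rewrite mulrDl mulrDr opprD (IHf gO) -scalerAl -scalerAr (genv_odd1C _ gO) scalerN.
Qed.

Lemma odd1_sqr f : f \in odd1 -> f * f = 0.
Proof.
move=> fO; have /eqP := odd1C fO fO.
rewrite -addr_eq0 -mulr2n -scaler_nat scaler_eq0 => /orP[|/eqP //].
by rewrite Num.Theory.pnatr_eq0.
Qed.

Lemma odd1_family (T : eqType) (w : T -> V n) : (forall e, w e \in odd1) -> odd_family w.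
Proof. by move=> wO; split=> [e|e e']; [apply: odd1_sqr | apply: odd1C]. Qed.

Lemma xg_odd1 i : xg i \in odd1. Proof. exact: genv_odd1. Qed.
Lemma yg_odd1 i : yg i \in odd1. Proof. exact: genv_odd1. Qed.
Lemma omega_odd1 i j : omega i j \in odd1.
Proof. by rewrite /omega; case: insub => [p|]; rewrite ?mem0v ?genv_odd1. Qed.

Section Ext.
Variable F : gen n -> V n.
Hypothesis oddF : odd_family F.

(** The universal property of the exterior algebra: since [F] is an odd family, this is the algebra
    endomorphism with value [F x] at the generator [x]. *)
Definition extension f : V n := \sum_A f A *: prodw F (enum A).

Lemma extension_is_linear : linear extension.
Proof.
move=> a f g; rewrite /extension scaler_sumr -big_split; apply: eq_bigr => A _ /=.
by rewrite !ffunE scalerDl scalerA.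
Qed.
HB.instance Definition _ := GRing.isLinear.Build rat (V n) (V n) _ extension extension_is_linear.

Lemma extension_mono A : extension (mono A) = prodw F (enum A).
Proof.
rewrite /extension (bigD1 A) //= big1 ?addr0 ?ffunE ?eqxx ?scale1r // => B /negPf BA.
by rewrite ffunE BA scale0r.
Qed.

(** Sorting [s] costs the same sign on both sides by [prodw_perm], and both sides are zero when [s]
    has a repetition. *)
Lemma extension_prodw s : extension (prodw (@genv n) s) = prodw F s.
Proof.
have [us|nus] := boolP (uniq s); last by rewrite !prodw_nonuniq ?linear0 //; apply: genv_odd.
have [b Hb] := prodw_perm (prodw_enum_perm us).
rewrite (Hb _ _ oddF) (Hb _ _ (@genv_odd n)) !mulr_sign -mono_prodw.
by case: b {Hb}; rewrite ?linearN /= extension_mono.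
Qed.

Lemma extensionM f g : extension (f * g) = extension f * extension g.
Proof.
elim/(@mono_ind n): f => [|a A f IHf]; first by rewrite mul0r !linear0 mul0r.
rewrite mulrDl !linearD /= IHf mulrDl; congr (_ + _).
rewrite -scalerAl !linearZ /= -scalerAl; congr (_ *: _).
elim/(@mono_ind n): g {IHf} => [|b B g IHg]; first by rewrite mulr0 !linear0 mulr0.
rewrite mulrDr !linearD /= IHg mulrDr; congr (_ + _).
rewrite -scalerAr !linearZ /= -scalerAr; congr (_ *: _).
by rewrite !mono_prodw -prodw_cat !extension_prodw prodw_cat.
Qed.

Lemma extension_genv x : extension (genv x) = F x.
Proof. by have := extension_prodw [:: x]; rewrite !prodw_cons !prodw_nil !mulr1. Qed.

Lemma extension1 : extension 1 = 1.
Proof. by have := extension_prodw [::]; rewrite !prodw_nil. Qed.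

End Ext.
End Extensions.

(** * The differential as a graded derivation *)

Section Differential.
Variable n : nat.
Implicit Types (f g : V n) (A B : {set gen n}) (x y : gen n) (s t : seq (gen n)).

Lemma mulmx2E (R : nzRingType) (M N : 'M[R]_2) i j :
  (M * N) i j = M i 0 * N 0 j + M i 1 * N 1 j.
Proof.
by rewrite mxE !big_ord_recl big_ord0 addr0 (_ : lift ord0 ord0 = 1) //; apply: val_inj.
Qed.

Lemma matrix2P (R : nzRingType) (M N : 'M[R]_2) :
  M 0 0 = N 0 0 -> M 0 1 = N 0 1 -> M 1 0 = N 1 0 -> M 1 1 = N 1 1 -> M = N.
Proof.
move=> e00 e01 e10 e11; apply/matrixP => i j.
have ord2 (k : 'I_2) : k = 0 \/ k = 1.
  by case: k => -[|[|k]] //= lk; [left | right]; apply: val_inj.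
by case: (ord2 i) => ->; case: (ord2 j) => ->.
Qed.

Lemma matrix2_oppP (R : nzRingType) (M N : 'M[R]_2) :
  M 0 0 = - N 0 0 -> M 0 1 = - N 0 1 -> M 1 0 = - N 1 0 -> M 1 1 = - N 1 1 -> M = - N.
Proof. by move=> e00 e01 e10 e11; apply: matrix2P; rewrite [RHS]mxE. Qed.

(** A value of [dgen] is zero or a product of two odd elements, so it passes an odd element with two
    sign changes. *)
Lemma dgenC x f : f \in odd1 n -> dgen x * f = f * dgen x.
Proof.
move=> fO; case: x => [_|p] /=; first by rewrite mul0r mulr0.
have uO : xg (val p).1 - xg (val p).2 \in odd1 n by rewrite rpredB ?xg_odd1.
have vO : yg (val p).1 - yg (val p).2 \in odd1 n by rewrite rpredB ?yg_odd1.
rewrite mulE; move: (xg _ - _) (yg _ - _) uO vO => u v uO vO.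
rewrite -mulrA (odd1C vO fO) mulrN [u * (f * v)]mulrA (odd1C uO fO).
by rewrite mulNr opprK mulrA.
Qed.

Lemma dgen_edge (p : Pair n) :
  dgen (inr p) = (xg (val p).1 - xg (val p).2) * (yg (val p).1 - yg (val p).2).
Proof. by []. Qed.

Lemma dgen_point (i : 'I_n + 'I_n) : dgen (inl i) = 0.
Proof. by []. Qed.

(* Upper triangular matrices turn the graded Leibniz rule into multiplicativity: the upper right
   entry of the product of the matrices of the factors of a monomial is its differential. *)
Definition twist x : 'M[V n]_2 :=
  \matrix_(i, j) if i == 0 then (if j == 0 then - genv x else dgen x)
                 else (if j == 0 then 0 else genv x).

Lemma twist00 x : twist x 0 0 = - genv x. Proof. by rewrite mxE. Qed.
Lemma twist01 x : twist x 0 1 = dgen x. Proof. by rewrite mxE. Qed.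
Lemma twist10 x : twist x 1 0 = 0. Proof. by rewrite mxE. Qed.
Lemma twist11 x : twist x 1 1 = genv x. Proof. by rewrite mxE. Qed.
Definition twistE := (twist00, twist01, twist10, twist11).

Local Opaque twist genv dgen.

Lemma twistM00 x y : (twist x * twist y) 0 0 = genv x * genv y.
Proof. by rewrite mulmx2E twist00 twist10 mulr0 addr0 twist00 mulrNN. Qed.
Lemma twistM01 x y : (twist x * twist y) 0 1 = dgen x * genv y - dgen y * genv x.
Proof.
rewrite mulmx2E (twist00 x) (twist01 y) (twist01 x) (twist11 y) mulNr addrC.
by rewrite -(dgenC y) ?genv_odd1.
Qed.
Lemma twistM10 x y : (twist x * twist y) 1 0 = 0.
Proof. by rewrite mulmx2E !twist10 mulr0 mul0r addr0. Qed.
Lemma twistM11 x y : (twist x * twist y) 1 1 = genv x * genv y.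
Proof. by rewrite mulmx2E twist10 !twist11 mul0r add0r. Qed.

(** The off-diagonal entry [dgen x * genv y - dgen y * genv x] of a product is antisymmetric in [x]
    and [y]. With this, [prodw_perm] applies to the matrices. *)
Lemma twist_odd : odd_family twist.
Proof.
have zeroE i j : (0 : 'M[V n]_2) i j = 0 by rewrite mxE.
split=> [x|x y].
  apply: matrix2P; rewrite zeroE.
  - by rewrite twistM00 (genv_odd n).1.
  - by rewrite twistM01 subrr.
  - exact: twistM10.
  - by rewrite twistM11 (genv_odd n).1.
apply: matrix2_oppP.
- exact: etrans (twistM00 x y) (etrans ((genv_odd n).2 x y) (congr1 -%R (esym (twistM00 y x)))).
- apply: etrans (twistM01 x y) (etrans _ (congr1 -%R (esym (twistM01 y x)))).
  by rewrite opprB.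
- exact: etrans (twistM10 x y) (etrans (esym (oppr0 _)) (congr1 -%R (esym (twistM10 y x)))).
- exact: etrans (twistM11 x y) (etrans ((genv_odd n).2 x y) (congr1 -%R (esym (twistM11 y x)))).
Qed.

Definition derivation s : V n := prodw twist s 0 1.

Lemma prodw_twist10 s : prodw twist s 1 0 = 0.
Proof.
elim: s => [|x s IH]; first by rewrite prodw_nil mxE.
by rewrite prodw_cons mulmx2E IH !twistE mul0r mulr0 addr0.
Qed.

Lemma prodw_twist11 s : prodw twist s 1 1 = prodw (@genv n) s.
Proof.
elim: s => [|x s IH]; first by rewrite !prodw_nil mxE.
by rewrite !prodw_cons mulmx2E IH !twistE mul0r add0r.
Qed.

Lemma prodw_twist00 s : prodw twist s 0 0 = prodw (fun x => - genv x) s.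
Proof.
elim: s => [|x s IH]; first by rewrite !prodw_nil mxE.
by rewrite !prodw_cons mulmx2E IH prodw_twist10 !twistE mulr0 addr0.
Qed.

Lemma derivation_nil : derivation [::] = 0.
Proof. by rewrite /derivation prodw_nil mxE. Qed.

Lemma derivation_cons x s :
  derivation (x :: s) = dgen x * prodw (@genv n) s - genv x * derivation s.
Proof. by rewrite /derivation prodw_cons mulmx2E prodw_twist11 !twistE mulNr addrC. Qed.

(** Unfolding the recursion gives one sign for each generator before [x]; along [enum A] this is the
    sum that defines [d2mono]. *)
Lemma derivation_sorted s : sorted (@rank_lt n) s ->
  derivation s = \sum_(x <- s)
    (-1) ^+ size [seq y <- s | rank_lt y x] *:
      (prodw (@genv n) [seq y <- s | rank_lt y x] * dgen x *
       prodw (@genv n) [seq y <- s | rank_lt x y]).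
Proof.
elim: s => [|x s IH]; first by rewrite derivation_nil big_nil.
rewrite derivation_cons /= path_sortedE; last exact: rank_lt_trans.
case/andP => /allP xs ss; rewrite big_cons (IH ss) /=.
have rltnn y : rank_lt y y = false by rewrite /rank_lt ltnn.
have nrlt y : y \in s -> rank_lt y x = false.
  by move=> /xs; rewrite /rank_lt; case: ltngtP.
rewrite !rltnn (eq_in_filter (a2 := pred0)) // filter_pred0 prodw_nil scale1r mul1r.
rewrite (eq_in_filter (a1 := rank_lt x) (a2 := predT)) => [|y /xs //].
rewrite filter_predT; congr (_ + _).
rewrite mulr_sumr -sumrN; apply: eq_big_seq => y ys.
rewrite nrlt // xs //= exprS mulN1r scaleNr -scalerAr prodw_cons.
by rewrite !mulrA.
Qed.

Lemma d2mono_derivation A : d2mono A = derivation (enum A).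
Proof.
rewrite derivation_sorted; last exact: sorted_enum.
rewrite /d2mono -big_enum /=.
by apply: eq_bigr => x _; rewrite !prodlE !big_map.
Qed.

Lemma d2fun_is_linear : linear (@d2fun n).
Proof.
move=> a f g; rewrite /d2fun scaler_sumr -big_split; apply: eq_bigr => A _ /=.
by rewrite !ffunE scalerDl scalerA.
Qed.
HB.instance Definition _ := GRing.isLinear.Build rat (V n) (V n) _ (@d2fun n) d2fun_is_linear.

(* [d2 n f] is elaborated at a vector-space instance that unification cannot match with the
   ring structure of [V n]. *)
Definition diff f : V n := d2 n f.

Lemma diffD f g : diff (f + g) = diff f + diff g.
Proof. exact: linearD. Qed.

Lemma diffZ a f : diff (a *: f) = a *: diff f.
Proof. exact: linearZ. Qed.

Lemma diff0 : diff 0 = 0.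
Proof. exact: linear0. Qed.

Lemma diffN f : diff (- f) = - diff f.
Proof. exact: linearN. Qed.

(** Reordering changes both sides by the same sign, and on a list with a repetition both vanish
    because [twist] is an odd family. *)
Lemma diff_prodw s : diff (prodw (@genv n) s) = derivation s.
Proof.
have d2_mono A : diff (mono A) = derivation (enum A).
  rewrite /diff lfunE /= /d2fun (bigD1 A) //= big1 ?addr0 ?ffunE ?eqxx ?scale1r ?d2mono_derivation //.
  by move=> B /negPf BA; rewrite ffunE BA scale0r.
have [us|nus] := boolP (uniq s); last first.
  rewrite prodw_nonuniq ?diff0 //; last exact: genv_odd.
  by rewrite /derivation prodw_nonuniq ?mxE //; exact: twist_odd.
have [b Hb] := prodw_perm (prodw_enum_perm us).
rewrite /derivation (Hb _ _ twist_odd) (Hb _ _ (@genv_odd n)) !mulr_sign -mono_prodw.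
by case: b {Hb}; rewrite ?diffN d2_mono ?mxE.
Qed.

(** The grading involution, multiplication by (-1)^d in total degree d; it carries the sign of the
    graded Leibniz rule. *)
Definition sign_involution : V n -> V n := extension (fun x => - genv x).

Lemma opp_genv_odd : odd_family (fun x => - @genv n x).
Proof. by apply: odd1_family => x; rewrite rpredN genv_odd1. Qed.

(** For monomials this is the upper right entry of the product of the matrices attached to the two
    lists of generators; bilinearity gives the rest. *)
Lemma diffM f g : diff (f * g) = diff f * g + sign_involution f * diff g.
Proof.
have invD h k : sign_involution (h + k) = sign_involution h + sign_involution k.
  exact: linearD.
have invZ c h : sign_involution (c *: h) = c *: sign_involution h by exact: linearZ.
elim/(@mono_ind n): f => [|a A f IHf].
  by rewrite mul0r diff0 mul0r add0r /sign_involution linear0 mul0r.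
rewrite mulrDl invD !diffD IHf !mulrDl addrACA; congr (_ + _).
suff key : diff (mono A * g) = diff (mono A) * g + sign_involution (mono A) * diff g.
  rewrite invZ -scalerAl !diffZ key.
  exact: etrans (scalerDr a _ _) (congr2 +%R (scalerAl a _ _) (scalerAl a _ _)).
elim/(@mono_ind n): g {IHf} => [|b B g IHg]; first by rewrite diff0 !mulr0 diff0 addr0.
rewrite mulrDr !diffD IHg !mulrDr addrACA; congr (_ + _).
suff key : diff (mono A * mono B) =
    diff (mono A) * mono B + sign_involution (mono A) * diff (mono B).
  rewrite -scalerAr !diffZ key.
  exact: etrans (scalerDr b _ _) (congr2 +%R (scalerAr b _ _) (scalerAr b _ _)).
rewrite !mono_prodw -prodw_cat !diff_prodw /sign_involution extension_prodw; last exact: opp_genv_odd.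
by rewrite /derivation prodw_cat mulmx2E prodw_twist11 prodw_twist00 addrC.
Qed.

Lemma sign_involution_odd1 f : f \in odd1 n -> sign_involution f = - f.
Proof.
elim/odd1_ind: f / => [|a x f IH]; first by rewrite /sign_involution linear0 oppr0.
rewrite /sign_involution linearD linearZ /= extension_genv; last exact: opp_genv_odd.
by rewrite -/sign_involution IH scalerN opprD.
Qed.

Lemma diff_odd1M f g : f \in odd1 n -> diff (f * g) = diff f * g - f * diff g.
Proof. by move=> fO; rewrite diffM sign_involution_odd1 // mulNr. Qed.

Lemma diff_genv x : diff (genv x) = dgen x.
Proof.
have := diff_prodw [:: x]; rewrite derivation_cons derivation_nil prodw_cons prodw_nil.
by rewrite !mulr1 mulr0 subr0.
Qed.

Lemma omega_diag i : omega i i = 0 :> V n.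
Proof. by rewrite /omega /uedge /= ltnn insubF //= ltnn. Qed.

Lemma diff_omega i j : diff (omega i j) = (xg i - xg j) * (yg i - yg j).
Proof.
have [ij|ji|/val_inj ->] := ltngtP i j; last by rewrite omega_diag diff0 subrr mul0r.
- by rewrite /omega /uedge /= ij insubT diff_genv dgen_edge.
rewrite /omega /uedge /= ltnNge (ltnW ji) /= insubT diff_genv dgen_edge /=.
by rewrite -mulrNN !opprB.
Qed.

Lemma diff_xg i : diff (xg i) = 0.
Proof. exact: etrans (diff_genv _) (dgen_point _). Qed.

Lemma diff_yg i : diff (yg i) = 0.
Proof. exact: etrans (diff_genv _) (dgen_point _). Qed.
End Differential.

(** * The elements L_C as alternating double deletions *)

Section CircuitElements.
Variable n : nat.
Local Notation edge := ('I_n * 'I_n)%type.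
Implicit Types (f g : V n) (c : seq 'I_n) (es : seq edge) (z : 'I_n -> V n).

Definition omega_edge (e : edge) : V n := omega e.1 e.2.
Definition increment z (e : edge) : V n := z e.2 - z e.1.

(** Numbering the edges from an offset [o] lets the inductions pass to the tail of the list. *)
Let index_edges o es := zip (iota o (size es)) es.

Let index_ge o es p : p \in index_edges o es -> (o <= p.1)%N.
Proof.
move=> /(map_f fst); rewrite [map _ _]unzip1_zip ?size_iota //.
by rewrite mem_iota => /andP[].
Qed.

Let filter_head o es b : (b < o)%N ->
  [seq e <- index_edges o es | e.1 != b] = index_edges o es.
Proof.
move=> bo; apply/all_filterP/allP => p /index_ge op.
by rewrite neq_ltn (leq_trans bo op) orbT.
Qed.

Let prod_index w o es : prodl [seq w e.2 | e <- index_edges o es] = prodw w es :> V n.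
Proof.
rewrite prodlE (map_comp w snd) [X in map w X]unzip2_zip ?size_iota //.
by rewrite big_map.
Qed.

Let sum_delete o es :
  \sum_(b <- index_edges o es) (-1) ^+ b.1 *:
    prodl [seq omega_edge e.2 | e <- index_edges o es & e.1 != b.1]
  = (-1) ^+ o *: deletion omega_edge es.
Proof.
elim: es o => [|e es IH] o; first by rewrite big_nil scaler0.
rewrite [index_edges _ _]/= big_cons /= eqxx /=.
rewrite filter_head // prod_index scalerBr; congr (_ + _).
rewrite -scalerN -mulrN -[in RHS]scaleN1r -scalerAr scalerA mulrC -exprS.
rewrite scalerAr -(IH o.+1) mulr_sumr; apply: eq_big_seq => b /index_ge ob.
by rewrite neq_ltn ob /= -scalerAr.
Qed.

Variable z : 'I_n -> V n.
Hypothesis z_odd1 : forall i, z i \in odd1 n.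

Lemma increment_odd1 e : increment z e \in odd1 n.
Proof. by rewrite rpredB. Qed.

Lemma omega_edge_odd1 e : omega_edge e \in odd1 n.
Proof. exact: omega_odd1. Qed.

(** A shift of all indices by [o] changes i + j by an even number, so, unlike in [sum_delete], the
    result carries no sign from [o]. *)
Let sum_delete2 o es :
  \sum_(a <- index_edges o es) \sum_(b <- index_edges o es | (a.1 < b.1)%N)
    (-1) ^+ (a.1 + b.1) *: (increment z a.2 *
      prodl [seq omega_edge e.2 | e <- index_edges o es & (e.1 != a.1) && (e.1 != b.1)])
  = deletion2 omega_edge (increment z) es.
Proof.
elim: es o => [|e es IH] o; first by rewrite big_nil.
have gt_o b : b \in index_edges o.+1 es -> (o < b.1)%N by apply: index_ge.
have neq_o b : b \in index_edges o.+1 es -> (o != b.1) /\ (b.1 != o).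
  by move/gt_o => ob; rewrite !neq_ltn ob orbT.
rewrite [index_edges _ _]/= -/(index_edges o.+1 es) big_cons /= big_cons /= ltnn; congr (_ + _).
  (* Pairs whose smaller index is that of the head: the head is deleted with its increment as
     weight, together with one edge of the tail. *)
  have -> : deletion omega_edge es = - \sum_(b <- index_edges o.+1 es)
      (-1) ^+ (o + b.1) *:
        prodl [seq omega_edge x.2 | x <- index_edges o.+1 es & x.1 != b.1].
    under eq_bigr => b _ do rewrite exprD -scalerA.
    rewrite -scaler_sumr sum_delete scalerA exprS mulrCA -exprD -signr_odd oddD addbb.
    by rewrite expr0 mulr1 scaleN1r opprK.
  rewrite mulrN opprK mulr_sumr big_seq_cond [RHS]big_seq_cond.
  apply: eq_big => b; first by case: (boolP (b \in _)) => // /gt_o ->.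
  case/andP=> bes _; rewrite eqxx /= -scalerAr; congr (_ *: (_ * _)).
  congr prodl; congr map; apply: eq_in_filter => x xes.
  by rewrite (neq_o _ xes).2.
(* Pairs inside the tail: the head remains as the first factor, and moving it past the increment
   gives the minus sign. *)
rewrite -(IH o.+1) mulr_sumr -sumrN; apply: eq_big_seq => a aes.
rewrite big_cons /= ltnNge (ltnW (gt_o _ aes)) /= mulr_sumr -sumrN.
rewrite big_seq_cond [RHS]big_seq_cond; apply: eq_bigr => b /andP[bes _].
rewrite (neq_o _ aes).1 (neq_o _ bes).1 /=.
rewrite -scalerAr -scalerN; congr (_ *: _).
by rewrite mulE !mulrA (odd1C (increment_odd1 _) (omega_edge_odd1 _)) mulNr.
Qed.

Lemma LgenE c : Lgen z c = deletion2 omega_edge (increment z) (cedges c).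
Proof. exact: (sum_delete2 0). Qed.

End CircuitElements.

Lemma coef_add n (f g : V n) U : (f + g) U = f U + g U.
Proof. by rewrite ffunE. Qed.

Lemma coef_opp n (f : V n) U : (- f) U = - f U.
Proof. by rewrite ffunE. Qed.

(* Restating these laws at [V n] makes all products in the result syntactically uniform, so that
   [generalize] below identifies equal monomials. *)
Lemma mulVDl n (f g h : V n) : (f + g) * h = f * h + g * h.
Proof. exact: mulrDl. Qed.
Lemma mulVDr n (f g h : V n) : f * (g + h) = f * g + f * h.
Proof. exact: mulrDr. Qed.
Lemma mulVNl n (f g : V n) : (- f) * g = - (f * g).
Proof. exact: mulNr. Qed.
Lemma mulVNr n (f g : V n) : f * (- g) = - (f * g).
Proof. exact: mulrN. Qed.

(** Products are expanded and brought to a common order by the anticommutation rules [CA], then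
    treated as atoms; what remains is a linear identity between rational coordinates. *)
Ltac normalize CA :=
  rewrite ?(mulVDl, mulVDr, mulVNl, mulVNr, CA);
  repeat match goal with |- context [@GRing.mul ?R ?a ?b] => generalize (@GRing.mul R a b); intro end;
  apply/ffunP => ?; rewrite ?(coef_add, coef_opp);
  ring.

(** * The ideal of relations and cycles of d_2 *)

Section Ideal.
Variable n : nat.
Local Notation edge := ('I_n * 'I_n)%type.
Local Notation I := (Iideal n).
Implicit Types (f g h : V n) (A B : {set gen n}).
Local Opaque mul mono genv dgen omega.

Lemma Iideal_ind (P : V n -> Prop) : P 0 ->
  (forall a A r B f, r \in rels n -> P f -> P (a *: (mono A * r * mono B) + f)) ->
  forall f, f \in I -> P f.
Proof.
move=> P0 PD; apply: span_ind => // a v f /allpairsPdep[A [[r B] [_ rB ->]]] Pf /=.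
by apply: PD => //; case/allpairsP: rB => -[r' B'] /= [r'R _ [-> _]].
Qed.

Lemma mono_rel_in_Iideal A r B : r \in rels n -> mono A * r * mono B \in I.
Proof.
move=> rR; apply: memv_span.
apply/allpairsPdep; exists A, (r, B); split=> //; first by rewrite mem_enum.
by apply/allpairsP; exists (r, B); split=> //=; rewrite mem_enum.
Qed.

Lemma rel_in_Iideal f r g : r \in rels n -> f * r * g \in I.
Proof.
move=> rR; elim/(@mono_ind n): f => [|a A f IHf]; first by rewrite !mul0r mem0v.
rewrite !mulrDl rpredD // -!scalerAl rpredZ // {f IHf}.
elim/(@mono_ind n): g => [|b B g IHg]; first by rewrite mulr0 mem0v.
by rewrite mulrDr rpredD // -scalerAr rpredZ // mono_rel_in_Iideal.
Qed.

Lemma Iideal_mull f g : g \in I -> f * g \in I.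
Proof.
elim/Iideal_ind: g / => [|a A r B g rR IH]; first by rewrite mulr0 mem0v.
by rewrite mulrDr rpredD // -scalerAr rpredZ // !mulrA rel_in_Iideal.
Qed.

Lemma Iideal_mulr f g : f \in I -> f * g \in I.
Proof.
elim/Iideal_ind: f / => [|a A r B f rR IH]; first by rewrite mul0r mem0v.
by rewrite mulrDl rpredD // -scalerAl rpredZ // -[_ * mono B * g]mulrA rel_in_Iideal.
Qed.

Lemma xg_omega_in_rels i j : i != j -> (xg i - xg j) * omega i j \in rels n.
Proof.
move=> ij; rewrite mem_cat; apply/orP; left.
by apply/mapP; exists (i, j); rewrite ?mem_enum ?inE.
Qed.

Lemma yg_omega_in_rels i j : i != j -> (yg i - yg j) * omega i j \in rels n.
Proof.
move=> ij; rewrite !mem_cat; apply/orP; right; apply/orP; left.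
by apply/mapP; exists (i, j); rewrite ?mem_enum ?inE.
Qed.

Let increment_omega (z : 'I_n -> V n) :
  (forall i j, i != j -> (z i - z j) * omega i j \in rels n) ->
  forall e g, increment z e * (omega_edge e * g) \in I.
Proof.
move=> zR [i j] g; rewrite /increment /omega_edge /=.
have [->|ij] := eqVneq i j; first by rewrite omega_diag mul0r mulr0 mem0v.
rewrite mulrA -opprB mulNr mulNr rpredN -[_ * g]mul1r mulrA rel_in_Iideal //.
exact: zR.
Qed.

Definition increment_xg_omega := increment_omega xg_omega_in_rels.
Definition increment_yg_omega := increment_omega yg_omega_in_rels.

Section CircuitDifferential.
Variables (X Y w : edge -> V n) (d : V n -> V n).
Hypotheses (XO : forall e, X e \in odd1 n) (YO : forall e, Y e \in odd1 n).
Hypotheses (wO : forall e, w e \in odd1 n).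
Hypotheses (Xw : forall e g, X e * (w e * g) \in I) (Yw : forall e g, Y e * (w e * g) \in I).
Hypotheses (dB : forall f g, d (f - g) = d f - d g) (dN : forall f, d (- f) = - d f).
Hypotheses (d0 : d 0 = 0) (d1 : d 1 = 0).
Hypothesis dw : forall e f, d (w e * f) = X e * (Y e * f) - w e * d f.
Hypothesis dX : forall e f, d (X e * f) = - (X e * d f).

Let odd1CA f g h : f \in odd1 n -> g \in odd1 n -> f * (g * h) = - (g * (f * h)).
Proof. by move=> fO gO; rewrite !mulrA (odd1C fO gO) mulNr. Qed.

(** Adding an edge with values X, Y, w replaces P by wP, Q by P - wQ and L by -XQ - wL, so the five
    statements pass to the longer list together. [X], [Y] and [d] are kept abstract so that x and y
    can be exchanged afterwards. *)
Lemma circuit_differential (s : seq edge) :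
  let x := \sum_(e <- s) X e in let y := \sum_(e <- s) Y e in
  [/\ x * prodw w s \in I, y * prodw w s \in I,
      d (prodw w s) - x * (y * deletion w s) \in I,
      exists Z, d (deletion w s) - (x * Z - y * deletion2 w X s) \in I &
      exists M N, d (deletion2 w X s) - (x * M + y * N) \in I].
Proof.
elim: s => [|e s].
  rewrite /= !big_nil prodw_nil d0 d1 !mul0r !subrr; split; rewrite ?mem0v //.
    by exists 0; rewrite mul0r subrr subr0 mem0v.
  by exists 0, 0; rewrite mulr0 addr0 subrr mem0v.
rewrite /= !big_cons prodw_cons.
set x := \sum_(e <- s) X e; set y := \sum_(e <- s) Y e.
have xO : x \in odd1 n by apply: rpred_sum.
have yO : y \in odd1 n by apply: rpred_sum.
move: (prodw w s) (deletion w s) (deletion2 w X s) => P Q L.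
move: (X e) (Y e) (w e) (XO e) (YO e) (wO e) (Xw e) (Yw e) (@dw e) (@dX e).
move: x y xO yO => x y xO yO X' Y' w' X'O Y'O w'O Xw' Yw' dw' dX'.
have CA := (fun g => odd1CA g xO w'O, fun g => odd1CA g yO w'O,
  fun g => odd1CA g xO Y'O, fun g => odd1CA g yO X'O, fun g => odd1CA g xO X'O,
  fun g => odd1CA g Y'O X'O).
case=> [xP yP dP [Z dQ] [M [N dL]]]; split.
- rewrite mulrDl CA rpredB //; exact: Iideal_mull.
- rewrite mulrDl CA rpredB //; exact: Iideal_mull.
- rewrite dw'.
  (* The difference is regrouped into multiples of the induction hypotheses and of Xw and Yw, each
     in the ideal. *)
  have -> : X' * (Y' * P) - w' * d P - (X' + x) * ((Y' + y) * (P - w' * Q)) =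
      - (w' * (d P - x * (y * Q))) - X' * (y * P) + X' * (Y' * (w' * Q))
      - X' * (w' * (y * Q)) + Y' * (x * P) - x * (y * P) + x * (Y' * (w' * Q)).
    by normalize CA.
  have := (Iideal_mull w' dP, Iideal_mull X' yP, Iideal_mull X' (Yw' Q), Xw' (y * Q),
    Iideal_mull Y' xP, Iideal_mull x yP, Iideal_mull x (Yw' Q)).
  by do ![case]; intros; rewrite ?(rpredB, rpredD, rpredN).
(* Read off from d(P - wQ) = xyQ - XYQ + w(xZ - yL) by splitting off (Y + y) times the new L and
   discarding multiples of Xw and Yw. *)
- exists (y * Q - w' * Z); rewrite dB dw'.
  have -> : d P - (X' * (Y' * Q) - w' * d Q) -
      ((X' + x) * (y * Q - w' * Z) - (Y' + y) * (- (X' * Q) - w' * L)) =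
      (d P - x * (y * Q)) + w' * (d Q - (x * Z - y * L)) + X' * (w' * Z) - Y' * (w' * L).
    by normalize CA.
  exact: rpredB (rpredD (rpredD dP (Iideal_mull w' dQ)) (Xw' Z)) (Yw' L).
(* Here d(-XQ - wL) = X(xZ - yL) - XYL + w(xM + yN). Once XX, Xw and Yw are discarded, the terms in
   Z and M are multiples of X + x, those in L and N of Y + y. *)
exists (- (X' * Z) - w' * M), (X' * L - w' * N); rewrite dB dN dX' dw'.
have -> : - - (X' * d Q) - (X' * (Y' * L) - w' * d L) -
    ((X' + x) * (- (X' * Z) - w' * M) + (Y' + y) * (X' * L - w' * N)) =
    X' * (d Q - (x * Z - y * L)) + w' * (d L - (x * M + y * N))
    + X' * (X' * Z) + X' * (w' * M) + Y' * (w' * N).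
  by normalize CA.
rewrite [X' * (X' * Z)]mulrA odd1_sqr // mul0r addr0.
exact: rpredD (rpredD (rpredD (Iideal_mull X' dQ) (Iideal_mull w' dL)) (Xw' M)) (Yw' N).
Qed.
End CircuitDifferential.
End Ideal.

(** * Closedness of L_C and L'_C, and stability of the ideal under d_2 *)

Section Cycles.
Variable n : nat.
Local Notation edge := ('I_n * 'I_n)%type.
Local Notation I := (Iideal n).
Implicit Types (f g h : V n) (A B : {set gen n}) (c : seq 'I_n) (es : seq edge).
Local Opaque mul mono genv dgen omega.

(** Around a circuit sources and targets run over the same vertices, so the increments cancel. *)
Lemma sum_increment_cedges (z : 'I_n -> V n) c :
  \sum_(e <- cedges c) increment z e = 0.
Proof.
rewrite /increment sumrB.
have unzip c1 c2 : size c1 = size c2 ->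
  \sum_(e <- zip c1 c2) z e.2 = \sum_(i <- c2) z i /\
  \sum_(e <- zip c1 c2) z e.1 = \sum_(i <- c1) z i.
  move=> e12; rewrite -[X in _ = \sum_(i <- X) _ /\ _](@unzip2_zip _ _ c1 c2) ?e12 //.
  by rewrite -[X in _ /\ _ = \sum_(i <- X) _](@unzip1_zip _ _ c1 c2) ?e12 // !big_map.
rewrite /cedges (unzip c (rot 1 c) _).1 ?(unzip c (rot 1 c) _).2 ?size_rot //.
by rewrite (perm_big c) ?subrr // perm_rot.
Qed.

Lemma diffB f g : diff (f - g) = diff f - diff g.
Proof. by rewrite diffD diffN. Qed.

Lemma diff1 : diff (1 : V n) = 0.
Proof. by rewrite -(prodw_nil (@genv n)) diff_prodw derivation_nil. Qed.

Lemma diff_increment (z : 'I_n -> V n) e f : (forall i, z i \in odd1 n) ->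
  (forall i, diff (z i) = 0) -> diff (increment z e * f) = - (increment z e * diff f).
Proof.
by move=> zO dz; rewrite diff_odd1M ?increment_odd1 // diffB !dz subrr mul0r add0r.
Qed.

Lemma diff_omega_edge e f :
  diff (omega_edge e * f) =
  increment (@xg n) e * (increment (@yg n) e * f) - omega_edge e * diff f.
Proof.
have dwe : diff (omega_edge e) = (xg e.1 - xg e.2) * (yg e.1 - yg e.2) :> V n.
  exact: diff_omega.
rewrite (diff_odd1M _ (omega_edge_odd1 e)) dwe -(opprB (xg e.2)) -(opprB (yg e.2)).
by rewrite mulrNN -mulrA.
Qed.

Let diff_closed es : \sum_(e <- es) increment (@xg n) e = 0 ->
  \sum_(e <- es) increment (@yg n) e = 0 ->
  diff (deletion (@omega_edge n) es) \in I /\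
  diff (deletion2 (@omega_edge n) (increment (@xg n)) es) \in I.
Proof.
move=> x0 y0.
have [] := @circuit_differential n (increment (@xg n)) (increment (@yg n)) (@omega_edge n)
  (@diff n) (increment_odd1 (@xg_odd1 n)) (increment_odd1 (@yg_odd1 n)) (@omega_edge_odd1 n)
  (@increment_xg_omega n) (@increment_yg_omega n) diffB (@diffN n) (@diff0 n) diff1
  diff_omega_edge (fun e f => diff_increment e f (@xg_odd1 n) (@diff_xg n)) es.
rewrite x0 y0 => _ _ _ [Z]; rewrite !mul0r !subr0 => -> [M [N]].
by rewrite !mul0r addr0 subr0.
Qed.

Let diff_closed' es : \sum_(e <- es) increment (@xg n) e = 0 ->
  \sum_(e <- es) increment (@yg n) e = 0 ->
  diff (deletion2 (@omega_edge n) (increment (@yg n)) es) \in I.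
Proof.
move=> x0 y0.
(* Exchanging x and y turns XY into YX = -XY, so it is [- diff] that satisfies the hypothesis on
   [d]. *)
have dw e f : - diff (omega_edge e * f) =
    increment (@yg n) e * (increment (@xg n) e * f) - omega_edge e * - diff f.
  rewrite diff_omega_edge opprB mulrN opprK addrC mulrA.
  by rewrite (odd1C (increment_odd1 (@xg_odd1 n) e) (increment_odd1 (@yg_odd1 n) e)) mulNr opprK mulrA.
have [] := @circuit_differential n (increment (@yg n)) (increment (@xg n)) (@omega_edge n)
  (fun f => - diff f) (increment_odd1 (@yg_odd1 n)) (increment_odd1 (@xg_odd1 n)) (@omega_edge_odd1 n)
  (@increment_yg_omega n) (@increment_xg_omega n) _ _ _ _ dw _ es.
- by move=> f g; rewrite diffB opprD.
- by move=> f; rewrite diffN.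
- by rewrite diff0 oppr0.
- by rewrite diff1 oppr0.
- by move=> e f; rewrite (diff_increment _ _ (@yg_odd1 n) (@diff_yg n)) mulrN.
rewrite x0 y0 => _ _ _ _ [M [N]].
by rewrite !mul0r addr0 subr0 rpredN.
Qed.

Lemma diff_LC c : diff (LC c) \in I.
Proof.
rewrite /LC (LgenE (@xg_odd1 n)).
exact: (diff_closed (sum_increment_cedges _ _) (sum_increment_cedges _ _)).2.
Qed.

Lemma diff_LC' c : diff (LC' c) \in I.
Proof.
rewrite /LC' (LgenE (@yg_odd1 n)).
exact: diff_closed' (sum_increment_cedges _ _) (sum_increment_cedges _ _).
Qed.

(** Makes the closedness of the Arnold relation an instance of the computation for circuits. *)
Lemma arnold_deletion i j k :
  arnold (i, j, k) = deletion (@omega_edge n) (cedges [:: i; j; k]).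
Proof.
rewrite /arnold /= /omega_edge !prodw_cons !prodw_nil /= !mulE !mulr0 !subr0 !mulr1 mulrBr opprB.
by rewrite (odd1C (omega_odd1 k i) (omega_odd1 i j)) [RHS]addrCA addrA.
Qed.

(** Relations are quadratic, hence even. The differentials of the first two kinds contain the square
    of an odd element. *)
Let d2_rel r : r \in rels n -> diff r \in I /\ sign_involution r = r.
Proof.
have uX i j : xg i - xg j \in odd1 n by rewrite rpredB ?xg_odd1.
have uY i j : yg i - yg j \in odd1 n by rewrite rpredB ?yg_odd1.
have invM f g : f \in odd1 n -> g \in odd1 n -> sign_involution (f * g) = f * g.
  move=> fO gO; rewrite /sign_involution extensionM; last exact: opp_genv_odd.
  by rewrite -!/(sign_involution _) !sign_involution_odd1 // mulrNN.
have invD f g : sign_involution (f + g) = sign_involution f + sign_involution g.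
  exact: linearD.
rewrite !mem_cat => /orP[|/orP[]] /mapP[].
- move=> [i j] _ -> /=; rewrite mulE (invM _ _ (uX i j) (omega_odd1 i j)); split=> //.
  rewrite (diff_odd1M _ (uX i j)) diff_omega diffB !diff_xg subrr mul0r add0r.
  by rewrite mulrA (odd1_sqr (uX i j)) mul0r oppr0 mem0v.
- move=> [i j] _ -> /=; rewrite mulE (invM _ _ (uY i j) (omega_odd1 i j)); split=> //.
  rewrite (diff_odd1M _ (uY i j)) diff_omega diffB !diff_yg subrr mul0r add0r.
  by rewrite (odd1C (uX i j) (uY i j)) mulrN mulrA (odd1_sqr (uY i j)) mul0r !oppr0 mem0v.
move=> [[i j] k] _ ->; split.
  rewrite arnold_deletion; exact: (diff_closed (sum_increment_cedges _ _) (sum_increment_cedges _ _)).1.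
by rewrite /arnold !mulE !invD !invM ?omega_odd1.
Qed.

(** This makes d_2 well defined on E_2 and puts the bidegree part of the ideal inside the space of
    cycles in [E3dim]. *)
Lemma diff_Iideal f : f \in I -> diff f \in I.
Proof.
elim/Iideal_ind: f / => [|a A r B f rR IH]; first by rewrite diff0 mem0v.
rewrite diffD diffZ rpredD // rpredZ // -mulrA diffM (diffM r) (d2_rel rR).2.
rewrite rpredD //; first by rewrite mulrA rel_in_Iideal.
apply: Iideal_mull; rewrite rpredD //; first exact: Iideal_mulr (d2_rel rR).1.
by rewrite -[r * _]mul1r mulrA rel_in_Iideal.
Qed.

End Cycles.

(** * Bidegrees of the circuit elements *)

Section Degrees.
Variable n : nat.
Local Notation edge := ('I_n * 'I_n)%type.
Implicit Types (f g h : V n) (A B : {set gen n}) (c : seq 'I_n) (s : seq edge).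
Local Opaque mul mono genv omega.

Lemma mono_comp p q A : degp A = p -> degq A = q -> mono A \in comp n p q.
Proof.
move=> pA qA; apply: memv_span; apply: map_f.
by rewrite mem_filter pA qA !eqxx mem_enum.
Qed.

Lemma genvM_comp x f p q :
  f \in comp n p q -> genv x * f \in comp n (isxy x + p) (~~ isxy x + q).
Proof.
rewrite {1}/comp; move: f; apply: span_ind => [|a v g]; first by rewrite mulr0 mem0v.
case/mapP => A; rewrite mem_filter => /andP[/andP[/eqP pA /eqP qA] _] -> gC.
rewrite mulrDr rpredD // -scalerAr rpredZ //.
have [xA|xNA] := boolP (x \in A).
  by rewrite mul_meeting_mono ?mem0v // disjoints1 xA.
rewrite mul_disjoint_mono ?disjoints1 ?xNA // rpredZ // mono_comp //.
- rewrite -pA /degp; case: (boolP (isxy x)) => xx.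
    rewrite (_ : [set _ in _ | _] = x |: [set g0 in A | isxy g0]).
      by rewrite cardsU1 inE (negPf xNA).
    by apply/setP => y; rewrite !inE; case: eqP => [->|].
  apply: eq_card => y; rewrite !inE; case: eqP => [->|] //=.
  by rewrite (negPf xx) andbF.
- rewrite -qA /degq; case: (boolP (isxy x)) => xx /=.
    apply: eq_card => y; rewrite !inE; case: eqP => [->|] //=.
    by rewrite xx andbF.
  rewrite (_ : [set _ in _ | _] = x |: [set g0 in A | ~~ isxy g0]).
    by rewrite cardsU1 inE (negPf xNA).
  by apply/setP => y; rewrite !inE; case: eqP => [->|].
Qed.

Lemma omegaM_comp i j f p q : f \in comp n p q -> omega i j * f \in comp n p q.+1.
Proof.
Transparent omega.
move=> fC; rewrite /omega; case: insub => [e|]; last by rewrite mul0r mem0v.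
exact: genvM_comp (inr e) _ _ _ fC.
Opaque omega.
Qed.

Lemma one_comp : (1 : V n) \in comp n 0 0.
Proof.
apply: mono_comp; rewrite ?/degp ?/degq; apply/eqP;
  by rewrite cards_eq0; apply/eqP/setP => x; rewrite !inE.
Qed.

Lemma prodw_comp s : prodw (@omega_edge n) s \in comp n 0 (size s).
Proof.
elim: s => [|e s IH]; first by rewrite prodw_nil one_comp.
by rewrite prodw_cons omegaM_comp.
Qed.

Lemma deletion_comp s : deletion (@omega_edge n) s \in comp n 0 (size s).-1.
Proof.
elim: s => [|e s IH] /=; first exact: mem0v.
rewrite rpredB ?prodw_comp //; case: s IH => [|e' s] IH; first by rewrite mulr0 mem0v.
exact: omegaM_comp.
Qed.

Lemma deletion2_comp (z : 'I_n -> V n) s :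
  (forall i f p q, f \in comp n p q -> z i * f \in comp n p.+1 q) ->
  deletion2 (@omega_edge n) (increment z) s \in comp n 1 (size s).-2.
Proof.
move=> zC; have iC e f p q : f \in comp n p q -> increment z e * f \in comp n p.+1 q.
  by move=> fC; rewrite mulrBl rpredB ?zC.
elim: s => [|e s IH] /=; first exact: mem0v.
rewrite rpredB ?rpredN //; first exact/iC/deletion_comp.
(* On lists of at most two edges [.-2] truncates; there the term keeping the head is zero. *)
case: s IH => [|e1 [|e2 s]] IH; last exact: omegaM_comp.
  by rewrite mulr0 mem0v.
by rewrite /= !mulr0 oppr0 addr0 mulr0 mem0v.
Qed.

Lemma size_cedges c : size (cedges c) = size c.
Proof. by rewrite size_zip size_rot minnn. Qed.

Lemma LC_comp c : LC c \in comp n 1 (size c).-2.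
Proof.
rewrite /LC (LgenE (@xg_odd1 n)) -size_cedges deletion2_comp // => i f p q.
exact: genvM_comp.
Qed.

Lemma LC'_comp c : LC' c \in comp n 1 (size c).-2.
Proof.
rewrite /LC' (LgenE (@yg_odd1 n)) -size_cedges deletion2_comp // => i f p q.
exact: genvM_comp.
Qed.

End Degrees.

(** * Edges of circuits *)

Section CycleEdges.
Variable n : nat.
Local Notation edge := ('I_n * 'I_n)%type.
Implicit Types (c s w : seq 'I_n) (e : edge).

Definition path_edges x s : seq edge := pairmap pair x s.

Lemma cedges_cons x s : cedges (x :: s) = rcons (path_edges x s) (last x s, x).
Proof.
rewrite /cedges rot1_cons; move: {2 5}x => y.
by elim: s x => //= x s IH z; rewrite IH.
Qed.

Lemma cedges_rot i c : perm_eq (cedges (rot i c)) (cedges c).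
Proof.
rewrite /cedges rot_rot; set d := rot 1 c.
have : size d = size c by rewrite size_rot.
move: d => d dc; have [ic|/ltnW ci] := leqP i (size c); last first.
  by rewrite !rot_oversize ?dc.
rewrite /rot zip_cat ?size_drop ?dc // perm_catC -zip_cat ?size_take ?dc //.
by rewrite !cat_take_drop.
Qed.

Lemma uedge_swap (i j : 'I_n) : uedge (j, i) = uedge (i, j).
Proof. by rewrite /uedge /=; case: ltngtP => // /val_inj ->. Qed.

Lemma uedge_cedges_rev a w :
  perm_eq (map (@uedge n) (cedges (a :: rev w))) (map (@uedge n) (cedges (a :: w))).
Proof.
have zipC s t : size s = size t ->
    map (@uedge n) (zip s t) = map (@uedge n) (zip t s).
  by elim: s t => [|x s IH] [|y t] //= [st]; rewrite IH // uedge_swap.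
rewrite /cedges !rot1_cons -rev_cons -rev_rcons -rev_zip ?size_rcons // map_rev.
by rewrite perm_rev zipC ?size_rcons.
Qed.

Lemma path_edges_neq x s e : uniq (x :: s) -> e \in path_edges x s -> e.1 != e.2.
Proof.
elim: s x => //= y s IH x /andP[xs us]; rewrite inE => /predU1P[->|]; last exact: IH.
by move: xs; rewrite inE negb_or => /andP[].
Qed.

Lemma mem_path_edges x s e : e \in path_edges x s -> e.1 \in x :: s /\ e.2 \in s.
Proof.
elim: s x => //= y s IH x; rewrite inE => /predU1P[->|/IH[e1 e2]] /=.
  by rewrite !mem_head.
by rewrite !inE -in_cons e1 e2 !orbT.
Qed.

Lemma cedges_neq c e : uniq c -> (2 <= size c)%N -> e \in cedges c -> e.1 != e.2.
Proof.
case: c => [|x [|y s]] // uc _; rewrite cedges_cons mem_rcons inE => /predU1P[->|] /=.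
  apply: contraTneq uc => /= <-; by rewrite mem_last.
exact: path_edges_neq uc.
Qed.

Definition touches a e := (e.1 == a) || (e.2 == a).

(** Each vertex of a circuit is the source of one edge and the target of one edge, and no edge is a
    loop. *)
Lemma count_touches a c : uniq c -> (2 <= size c)%N ->
  count (touches a) (cedges c) = (2 * (a \in c))%N.
Proof.
move=> uc sc; have := count_predUI (fun e : edge => e.1 == a) (fun e => e.2 == a) (cedges c).
rewrite (eq_in_count (a1 := predI _ _) (a2 := pred0)); last first.
  move=> e /(cedges_neq uc sc) /= neq; apply/negP => /andP[/eqP e1 /eqP e2].
  by rewrite e1 e2 eqxx in neq.
rewrite count_pred0 addn0 => -[->].
rewrite -[count (fun e => _ e.1 _) _](count_map fst (pred1 a)).
rewrite -[count (fun e => _ e.2 _) _](count_map snd (pred1 a)).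
rewrite [map fst _]unzip1_zip ?size_rot // [map snd _]unzip2_zip ?size_rot //.
by rewrite !count_uniq_mem ?rot_uniq // mem_rot addnn -mul2n.
Qed.

(** Normal form of a standard circuit: it starts at the greatest vertex [a] and goes first to the
    second greatest, [m]. *)
Definition apex (a m : 'I_n) (v : seq 'I_n) := [&& (m < a)%N, all (fun i : 'I_n => (i < m)%N) v & uniq v].

Lemma apex_uniq a m v : apex a m v -> uniq [:: a, m & v].
Proof.
case/and3P => ma /allP vm uv; rewrite /= uv andbT inE negb_or.
have mNv : m \notin v by apply/negP => /vm; rewrite ltnn.
have aNv : a \notin v by apply/negP => /vm /(ltn_trans ma); rewrite ltnn.
by rewrite mNv aNv -val_eqE gtn_eqF.
Qed.

(** Rotation brings the edge joining the two greatest vertices to the front; if it runs from the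
    smaller to the greater, the circuit is also reversed. *)
Lemma standard_apex c : circuit c -> standard c ->
  exists a m v, [/\ apex a m v, size [:: a, m & v] = size c &
    perm_eq (map (@uedge n) (cedges c)) (map (@uedge n) (cedges [:: a, m & v]))].
Proof.
case/andP => uc sc /existsP[e /andP[/imsetP[f fc ef] /allP topc]].
have sc2 : (2 <= size c)%N by apply: ltnW.
have fneq := cedges_neq uc sc2 fc.
have [e12 fe] : (e.1 < e.2)%N /\ (f = e \/ f = (e.2, e.1)).
  move: fneq; rewrite ef -val_eqE; case: (f) => i j /=; rewrite /uedge /=.
  case: (ltngtP i j) => // ij _; first by split; [exact: ij | left].
  by split; [exact: ij | right].
have [i [w rc]] : exists i w, rot i c = [:: f.1, f.2 & w].
  have f1c : f.1 \in c.
    move/(map_f fst): fc; by rewrite [map _ _]unzip1_zip ?size_rot.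
  have [i s rc] := rot_to f1c; exists i.
  move: fc; rewrite -(perm_mem (cedges_rot i c)) rc.
  have: uniq (f.1 :: s) by rewrite -rc rot_uniq.
  have : (2 <= size (f.1 :: s))%N by rewrite -rc size_rot.
  case: s {rc} => // y s _ /= /andP[f1s us]; rewrite cedges_cons mem_rcons !inE.
  case/or3P => [/eqP fx|/eqP fx|/mem_path_edges[f1 _]].
  - by rewrite {2}fx /= eqxx in fneq.
  - by exists s; rewrite fx.
  - by rewrite (negPf f1s) in f1.
have szw : size w = (size c).-2 by rewrite -(size_rot i c) rc.
have ucr : uniq [:: f.1, f.2 & w] by rewrite -rc rot_uniq.
have topw u : u \in w -> (u < e.1)%N.
  move=> uw; have uc' : u \in c by rewrite -(mem_rot i) rc !inE uw !orbT.
  have /or3P[/eqP eu|/eqP eu|/andP[]//] := topc _ uc'; exfalso.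
    by move: ucr; case: fe eu uw => -> /= <- uw; rewrite !inE uw ?orbT ?andbF.
  by move: ucr; case: fe eu uw => -> /= <- uw; rewrite !inE uw ?orbT ?andbF.
have uw : uniq w by case/and3P: ucr.
have permc := perm_map (@uedge n) (cedges_rot i c).
have szc : size c = (size w).+2 by rewrite -(size_rot i) rc.
exists e.2, e.1; case: fe => Ef.
  exists (rev w); split.
  - apply/and3P; split=> //; last by rewrite rev_uniq.
    by apply/allP => u; rewrite mem_rev; apply: topw.
  - by rewrite /= size_rev szc.
  rewrite perm_sym; apply: perm_trans permc.
  have -> : [:: e.2, e.1 & rev w] = e.2 :: rev (rcons w e.1) by rewrite rev_rcons.
  apply: perm_trans (uedge_cedges_rev _ _) _.
  rewrite rc Ef -[_ :: rcons w _](rot1_cons e.1 (e.2 :: w)).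
  exact: perm_map (cedges_rot _ _).
exists w; split.
- by apply/and3P; split=> //; apply/allP.
- by rewrite szc.
by rewrite perm_sym; apply: perm_trans permc; rewrite rc Ef.
Qed.

End CycleEdges.

(** * Functionals attached to cycles *)

Section Functional.
Variable n : nat.
Local Notation edge := ('I_n * 'I_n)%type.
Implicit Types (c s : seq 'I_n) (e : edge) (es : seq edge) (f g : V n).
Local Opaque mul mono genv omega dgen.

Variables (onx : bool) (a m : 'I_n) (v : seq 'I_n).
Local Notation block := (m :: v).
Local Notation pos i := (index i block).

Definition in_block e := (e.1 \in block) && (e.2 \in block).

(** Position in the block, not the order of the vertices, decides. On a tie the value is [m], which
    keeps [later] symmetric without side conditions. *)
Definition later e : 'I_n :=
  if (pos e.1 < pos e.2)%N then e.2 else if (pos e.2 < pos e.1)%N then e.1 else m.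

Definition edge_image e : V n := if in_block e then xg (later e) else 0.

(** [onx] selects whether x_a or y_a survives. Its image is [xg a] in both cases, so that one target
    monomial serves for L_C and L'_C. *)
Definition test_image (x : gen n) : V n :=
  match x with
  | inl (inl i) => if onx && (i == a) then xg a else 0
  | inl (inr i) => if ~~ onx && (i == a) then xg a else 0
  | inr p => edge_image (val p)
  end.

Definition test_map : V n -> V n := extension test_image.

Definition test_coef f : rat := test_map f [set inl (inl i) | i in a :: v].

Lemma test_image_odd : odd_family test_image.
Proof.
apply: odd1_family => -[[i|i]|p] /=; rewrite /edge_image; case: ifP => _;
  by rewrite ?xg_odd1 ?mem0v.
Qed.

Lemma test_mapD f g : test_map (f + g) = test_map f + test_map g.
Proof. exact: linearD. Qed.
Lemma test_mapN f : test_map (- f) = - test_map f.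
Proof. exact: linearN. Qed.
Lemma test_mapZ k f : test_map (k *: f) = k *: test_map f.
Proof. exact: linearZ. Qed.
Lemma test_map0 : test_map 0 = 0.
Proof. exact: linear0. Qed.
Lemma test_mapM f g : test_map (f * g) = test_map f * test_map g.
Proof. exact: (extensionM test_image_odd). Qed.
Lemma test_map_genv x : test_map (genv x) = test_image x.
Proof. exact: (extension_genv test_image_odd). Qed.
Lemma test_map_xg i : test_map (xg i) = if onx && (i == a) then xg a else 0.
Proof. exact: test_map_genv. Qed.
Lemma test_map_yg i : test_map (yg i) = if ~~ onx && (i == a) then xg a else 0.
Proof. exact: test_map_genv. Qed.

Lemma laterC i j : later (i, j) = later (j, i).
Proof. by rewrite /later /=; case: ltngtP. Qed.

Lemma in_blockC i j : in_block (i, j) = in_block (j, i).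
Proof. exact: andbC. Qed.

Lemma test_map_omega i j : test_map (omega i j) = if i != j then edge_image (i, j) else 0.
Proof.
Transparent omega.
have [->|/= ij] := eqVneq i j; first by rewrite omega_diag test_map0.
have [lij|lji|/val_inj Eij] := ltngtP i j; last by rewrite Eij eqxx in ij.
  by rewrite /omega /uedge /= lij insubT test_map_genv.
rewrite /omega /uedge /= ltnNge (ltnW lji) /= insubT test_map_genv /=.
by rewrite /edge_image in_blockC laterC.
Opaque omega.
Qed.

Hypothesis apex_amv : apex a m v.

Let uniq_amv : uniq [:: a, m & v] := apex_uniq apex_amv.

Let aNblock : a \notin block.
Proof. by case/andP: uniq_amv. Qed.

(** In the relations of the first two kinds, [omega i j] survives only inside the block, where every
    x and y dies because [a] lies outside it. *)
Lemma test_map_rels r : r \in rels n -> test_map r = 0.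
Proof.
have zrel (z : 'I_n -> V n) i j : (forall i, i != a -> test_map (z i) = 0) ->
    i != j -> test_map ((z i - z j) * omega i j) = 0.
  move=> z0 ij; rewrite test_mapM test_map_omega ij /edge_image.
  case: ifP => [/andP[/= ib jb]|]; last by rewrite mulr0.
  rewrite test_mapD test_mapN !z0 ?subrr ?mul0r //.
    by apply: contraNneq aNblock => <-.
  by apply: contraNneq aNblock => <-.
rewrite !mem_cat => /orP[|/orP[]] /mapP[].
- move=> [i j]; rewrite mem_enum inE /= => ij ->; apply: (zrel (@xg n)) => // k /negPf ka.
  by rewrite test_map_xg ka andbF.
- move=> [i j]; rewrite mem_enum inE /= => ij ->; apply: (zrel (@yg n)) => // k /negPf ka.
  by rewrite test_map_yg ka andbF.
move=> [[i j] k]; rewrite mem_enum inE /= => /and3P[ij jk ki] ->.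
rewrite /arnold !mulE !test_mapD !test_mapM !test_map_omega ij jk ki.
have xC p q : xg p * xg q = - (xg q * xg p) :> V n by apply: odd1C; apply: xg_odd1.
have xx p : xg p * xg p = 0 :> V n by apply: odd1_sqr; apply: xg_odd1.
rewrite /edge_image /in_block /=.
have [ib|ib] := boolP (i \in block); last by rewrite ?(andbF, mul0r, mulr0, addr0).
have [jb|jb] := boolP (j \in block); last by rewrite ?(andbF, mul0r, mulr0, addr0).
have [kb|kb] := boolP (k \in block); last by rewrite ?(andbF, mul0r, mulr0, addr0).
have pos_neq p q : p \in block -> q \in block -> p != q -> pos p != pos q.
  by move=> pb qb; apply: contra_neq => pq; rewrite -(nth_index m pb) pq nth_index.
rewrite /later /=.
move: (pos_neq _ _ ib jb ij) (pos_neq _ _ jb kb jk) (pos_neq _ _ kb ib ki).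
(* Of three distinct positions one is last and its two edges have equal images; the cyclic
   comparisons are contradictory. *)
case: (ltngtP (pos i) (pos j)) => // lij _; case: (ltngtP (pos j) (pos k)) => // ljk _;
  case: (ltngtP (pos k) (pos i)) => // lki _; rewrite ?xx ?add0r ?addr0;
  by [rewrite xC addNr | have := ltn_trans lij (ltn_trans ljk lki); rewrite ltnn
     | have := ltn_trans ljk (ltn_trans lij lki); rewrite ltnn].
Qed.

Lemma test_map_Iideal f : f \in Iideal n -> test_map f = 0.
Proof.
elim/Iideal_ind: f / => [|k A r B f rR IH]; first exact: test_map0.
by rewrite test_mapD test_mapZ !test_mapM (test_map_rels rR) mulr0 mul0r scaler0 IH addr0.
Qed.

Lemma test_coef_Iideal f : f \in Iideal n -> test_coef f = 0.
Proof. by move=> /test_map_Iideal; rewrite /test_coef => ->; rewrite ffunE. Qed.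

Lemma test_map_deletion2 (z : 'I_n -> V n) es :
  test_map (deletion2 (@omega_edge n) (increment z) es) =
  deletion2 (fun e => test_map (omega_edge e)) (fun e => test_map (increment z e)) es.
Proof.
have prodE (s : seq edge) : test_map (prodw (@omega_edge n) s) = prodw (fun e => test_map (omega_edge e)) s.
  elim: s => [|e s IH]; last by rewrite !prodw_cons test_mapM IH.
  by rewrite !prodw_nil; exact: (extension1 test_image_odd).
have delE (s : seq edge) : test_map (deletion (@omega_edge n) s) =
    deletion (fun e => test_map (omega_edge e)) s.
  elim: s => [|e s IH] /=; first exact: test_map0.
  by rewrite test_mapD test_mapN prodE test_mapM IH.
elim: es => [|e s IH] /=; first exact: test_map0.
by rewrite test_mapD !test_mapN !test_mapM delE IH.
Qed.

Definition residual c := [seq e <- cedges c | predC (touches a) e].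

(** Characterises the circuits on which [test_coef] does not vanish, by [test_coef_cycle]. *)
Definition hits c := [&& a \in c, all in_block (residual c) & perm_eq (map later (residual c)) v].

Lemma test_map_odd1 f : f \in odd1 n -> test_map f \in odd1 n.
Proof.
elim/odd1_ind: f / => [|k x f IH]; first by rewrite test_map0 mem0v.
rewrite test_mapD test_mapZ rpredD ?rpredZ // test_map_genv.
by case: x => [[i|i]|p] /=; rewrite /edge_image; case: ifP => _; rewrite ?xg_odd1 ?mem0v.
Qed.

(** Edges at [a] map to zero, [a] being outside the block, and a circuit through [a] has exactly two
    of them; [deletion2_two_zeros] leaves the term deleting both. On a circuit avoiding [a] all
    increments map to zero. *)
Lemma test_map_cycle (z : 'I_n -> V n) c : uniq c -> (2 <= size c)%N ->
  (forall i, z i \in odd1 n) -> (forall i, test_map (z i) = if i == a then xg a else 0) ->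
  if a \in c then
    exists b : bool, test_map (deletion2 (@omega_edge n) (increment z) (cedges c)) =
      (-1) ^+ b * (xg a * prodw edge_image (residual c))
  else test_map (deletion2 (@omega_edge n) (increment z) (cedges c)) = 0.
Proof.
move=> uc sc zO za; rewrite test_map_deletion2.
have incE e : test_map (increment z e) = (if e.2 == a then xg a else 0) - (if e.1 == a then xg a else 0).
  by rewrite test_mapD test_mapN !za.
have cnt := count_touches a uc sc.
case: ifP cnt => ac cnt; last first.
  have : ~~ has (touches a) (cedges c) by rewrite has_count cnt.
  move/hasPn => nt; apply: deletion2_eq0 => e /nt.
  by rewrite /touches negb_or incE => /andP[/negPf-> /negPf->]; rewrite subrr.
have tw e : touches a e -> test_map (omega_edge e) = 0.
  case: e => i j /orP[]/eqP /= ->; rewrite /omega_edge test_map_omega /edge_image /in_block /=;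
  by rewrite (negPf aNblock) ?andbF; case: ifP.
have [||b [e [ec te ->]]] := @deletion2_two_zeros _ _ (touches a)
   (fun e => test_map (omega_edge e)) (fun e => test_map (increment z e)) tw _ (cedges c).
- by move=> e e'; apply: odd1C; apply: test_map_odd1; rewrite ?omega_edge_odd1 ?increment_odd1.
- by rewrite cnt.
have -> : prodw (fun e => test_map (omega_edge e)) (residual c) = prodw edge_image (residual c).
  apply: eq_in_prodw => -[i j]; rewrite mem_filter => /andP[_ /(cedges_neq uc sc) ij].
  by rewrite /omega_edge test_map_omega ij.
(* No edge is a loop, so exactly one end of [e] is [a], and the increment maps to plus or minus
   [xg a]. *)
have := cedges_neq uc sc ec; move: te; rewrite /touches incE.
case: eqP => [->|_] /=; last by move=> ->; rewrite subr0; exists b.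
rewrite eq_sym => _ /negPf->; exists (~~ b).
by rewrite sub0r mulNr !mulr_sign; case: b => /=; rewrite ?opprK.
Qed.

(** When the residual path stays in the block, the image is up to sign a product of generators.
    Equal labels kill it; distinct ones give a single monomial, to be compared with the target. *)
Lemma test_coef_cycle (z : 'I_n -> V n) c : uniq c -> (2 <= size c)%N ->
  (forall i, z i \in odd1 n) -> (forall i, test_map (z i) = if i == a then xg a else 0) ->
  (test_coef (deletion2 (@omega_edge n) (increment z) (cedges c)) != 0) = hits c.
Proof.
move=> uc sc zO za; have := test_map_cycle uc sc zO za; rewrite /test_coef /hits.
case: ifP => ac; last by move=> ->; rewrite ffunE eqxx.
case=> b ->; have [inb|/allPn[e er eb]] := boolP (all in_block (residual c)); last first.
  by rewrite (prodw0 er) ?mulr0 ?ffunE ?eqxx // /edge_image (negPf eb).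
set labels := map later (residual c).
have -> : xg a * prodw edge_image (residual c) = prodw (@genv n) [seq inl (inl i) | i <- a :: labels].
  rewrite prodw_cons; congr (_ * _); rewrite /prodw !big_map; apply: eq_big_seq => e er.
  by rewrite /edge_image (allP inb e er).
have inj : injective (fun i : 'I_n => inl (inl i) : gen n) by move=> i j [].
have uav : uniq (a :: v).
  by move: uniq_amv; rewrite /= inE negb_or => /and3P[/andP[_ an] _ uv]; apply/andP.
have [ul|nul] := boolP (uniq (a :: labels)); last first.
  rewrite (prodw_nonuniq (@genv_odd n)) ?(map_inj_uniq inj) // mulr0 ffunE eqxx.
  by apply/esym; apply: contraNF nul => pl; rewrite (perm_uniq (_ : perm_eq _ (a :: v))) ?perm_cons.
have [|b' ->] := @prodw_genv_uniq n [seq inl (inl i) | i <- a :: labels].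
  by rewrite (map_inj_uniq inj).
Transparent mono.
have signE k f U : (((-1) ^+ nat_of_bool k * f : V n) U != 0) = (f U != 0).
  by rewrite mulr_sign; case: k; rewrite ?ffunE ?oppr_eq0.
rewrite !signE ffunE.
have -> : ([set inl (inl i) | i in a :: v] ==
    [set x in [seq inl (inl i) | i <- a :: labels]] :> {set gen n}) = perm_eq labels v.
  rewrite -(perm_cons a); apply/eqP/idP => [/setP E|/perm_mem E].
    apply: uniq_perm => // i; have := E (inl (inl i)).
    by rewrite in_set (mem_imset _ _ inj) [X in _ = X -> _](mem_map inj (a :: labels) i) => ->.
  apply/setP => x; rewrite in_set; apply/imsetP/mapP => -[i ic ->]; exists i => //.
    by rewrite E.
  by rewrite -E.
by case: (perm_eq _ _); rewrite ?oner_eq0 ?eqxx.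
Qed.

Lemma test_coef_zero (z : 'I_n -> V n) es : (forall i, test_map (z i) = 0) ->
  test_coef (deletion2 (@omega_edge n) (increment z) es) = 0.
Proof.
move=> z0; rewrite /test_coef test_map_deletion2 deletion2_eq0 ?ffunE // => e _.
by rewrite test_mapD test_mapN !z0 subrr.
Qed.

End Functional.

(** * Which standard cycles a functional detects *)

Section Hits.
Variable n : nat.
Local Notation edge := ('I_n * 'I_n)%type.
Implicit Types (a m : 'I_n) (c u v : seq 'I_n) (e : edge).

Lemma uedgeP e : uedge e = e \/ uedge e = (e.2, e.1).
Proof. by case: e => i j; rewrite /uedge /=; case: ifP; [left | right]. Qed.

Lemma residual_uedge a c :
  map (@uedge n) (residual a c) = filter (predC (touches a)) (map (@uedge n) (cedges c)).
Proof.
rewrite filter_map; congr map; apply: eq_filter => e /=; congr negb.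
by case: (uedgeP e) => ->; rewrite // /touches orbC.
Qed.

Lemma all_in_block_uedge m v (es : seq edge) :
  all (in_block m v) (map (@uedge n) es) = all (in_block m v) es.
Proof.
by rewrite all_map; apply: eq_all => e /=; case: (uedgeP e) => ->; rewrite // in_blockC; case: e.
Qed.

Lemma map_later_uedge m v (es : seq edge) :
  map (later m v) (map (@uedge n) es) = map (later m v) es.
Proof.
by rewrite -map_comp; apply: eq_map => e /=; case: (uedgeP e) => ->; rewrite // laterC; case: e.
Qed.

(** Orientation and starting point do not affect [hits], so a standard circuit may be replaced by
    its normal form from [standard_apex]. *)
Lemma hits_uedge a m v c c' : uniq c -> uniq c' -> (2 <= size c)%N -> (2 <= size c')%N ->
  perm_eq (map (@uedge n) (cedges c)) (map (@uedge n) (cedges c')) ->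
  hits a m v c = hits a m v c'.
Proof.
move=> uc uc' sc sc' pcc'.
have memE d : uniq d -> (2 <= size d)%N -> (a \in d) = has (touches a) (map (@uedge n) (cedges d)).
  move=> ud sd; rewrite has_map (eq_has (a2 := touches a)).
    by rewrite has_count count_touches //; case: (a \in d).
  by move=> e /=; case: (uedgeP e) => ->; rewrite // /touches orbC.
have pr : perm_eq (map (@uedge n) (residual a c)) (map (@uedge n) (residual a c')).
  by rewrite !residual_uedge perm_filter.
rewrite /hits !memE // (perm_has _ pcc'); congr andb.
rewrite -(all_in_block_uedge m v (residual a c)) -(all_in_block_uedge m v (residual a c')).
rewrite (perm_all _ pr); congr andb.
rewrite -(map_later_uedge m v (residual a c)) -(map_later_uedge m v (residual a c')).
by have /permPl-> := perm_map (later m v) pr.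
Qed.

Lemma residual_apex a m v : uniq [:: a, m & v] -> residual a [:: a, m & v] = path_edges m v.
Proof.
move=> uamv; rewrite /residual cedges_cons filter_rcons /= /touches /= eqxx ?orbT /=.
apply/all_filterP/allP => e /mem_path_edges[e1 e2] /=.
case/andP: uamv => aN _; rewrite negb_or; apply/andP; split; apply: contraNneq aN => <- //.
by rewrite inE e2 orbT.
Qed.

Local Notation pos_lt m v := (fun i j => (index i (m :: v) < index j (m :: v))%N).

Lemma path_later m v x u : path (pos_lt m v) x u -> map (later m v) (path_edges x u) = u.
Proof. by elim: u x => //= y u IH x /andP[xy /IH ->]; rewrite /later /= xy. Qed.

(** A first step from [x] down to an earlier position would have [x] itself as label, against
    distinctness; after a step up the argument repeats from the next vertex. *)
Lemma later_path m v x u : {subset x :: u <= m :: v} -> uniq (x :: u) ->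
  uniq (x :: map (later m v) (path_edges x u)) -> path (pos_lt m v) x u.
Proof.
elim: u x => //= y u IH x sub /andP[xNu uu]; rewrite /later /=.
have xy : x != y by move: xNu; rewrite inE negb_or => /andP[].
have xb : x \in m :: v by rewrite sub ?mem_head.
have yb : y \in m :: v by rewrite sub // inE mem_head orbT.
have : index x (m :: v) != index y (m :: v).
  by apply: contra_neq xy => pxy; rewrite -(nth_index m xb) pxy nth_index.
case: ltngtP => // lxy _ /and3P[]; last by rewrite mem_head.
move=> _ yN ul; apply: IH => //.
  by move=> i iyu; apply: sub; rewrite inE iyu orbT.
by rewrite /= yN ul.
Qed.

Lemma path_pos m v : uniq (m :: v) -> path (pos_lt m v) m v.
Proof.
move=> umv; change (sorted (pos_lt m v) (m :: v)); apply/(sortedP m) => i si.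
by rewrite !index_uniq // ltnW.
Qed.

Lemma hits_refl a m v : apex a m v -> hits a m v [:: a, m & v].
Proof.
move=> amv; have uamv := apex_uniq amv.
rewrite /hits mem_head residual_apex // path_later ?perm_refl ?andbT /=; last first.
  by apply: path_pos; case/andP: uamv.
apply/allP => e /mem_path_edges[e1 e2]; rewrite /in_block e1 inE e2 orbT //.
Qed.

(** The path left after removing [a] must climb through the positions of m, v_1, ..., v_r, and the
    normal form fixes where it starts. *)
Lemma hits_apex_inj a m v a' m' u : apex a m v -> apex a' m' u -> u != [::] ->
  hits a m v [:: a', m' & u] -> [:: a', m' & u] = [:: a, m & v].
Proof.
move=> amv amu u0 /and3P[ac /allP inb pl].
have uamu := apex_uniq amu; have uamv := apex_uniq amv.
have le_a' i : i \in [:: a', m' & u] -> (i <= a')%N.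
  case/and3P: amu => ma /allP um _; rewrite !inE => /or3P[/eqP->|/eqP->|/um im] //.
    exact: ltnW.
  exact: ltnW (ltn_trans im ma).
have lt_a i : i \in m :: v -> (i < a)%N.
  by case/and3P: amv => ma /allP vm _; rewrite inE => /predU1P[->|/vm im] //; apply: ltn_trans ma.
(* Otherwise an edge at [a'] avoids [a] and is retained, which puts [a'] in the block and so below
   [a]; yet [a] is a vertex of the circuit, whose greatest vertex is [a']. If [m' = a], that edge is
   the closing one. *)
have Ea : a' = a.
  apply/eqP; apply: contraT => a'a.
  have : a' \in m :: v.
    have [/eqP m'a|m'a] := boolP (m' == a).
      have lu : last m' u \in u by case: (u) u0 => //= x s _; apply: mem_last.
      have : in_block m v (last m' u, a').
        apply: inb; rewrite mem_filter cedges_cons mem_rcons mem_head andbT /touches /=.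
        rewrite (negPf a'a) orbF -m'a; apply: contraTneq uamu => lm.
        by rewrite /= -{2}lm lu andbF.
      by case/andP.
    have : in_block m v (a', m').
      apply: inb; rewrite mem_filter cedges_cons mem_rcons !inE eqxx !orbT andbT /touches /=.
      by rewrite (negPf a'a) (negPf m'a).
    by case/andP.
  by move/lt_a; rewrite ltnNge le_a'.
move: uamu inb pl; rewrite {}Ea => uamu; rewrite residual_apex // => inb pl.
have sub : {subset m' :: u <= m :: v}.
  have sub' x s : (forall e, e \in path_edges x s -> in_block m v e) -> {subset s <= m :: v}.
    elim: s x => // y s IH x xs i; rewrite inE => /predU1P[->|].
      by have /andP[] := xs _ (mem_head _ _).
    by apply: (IH y) => e es; apply: xs; rewrite inE es orbT.
  move=> i; rewrite inE => /predU1P[->|]; last exact: sub' inb _.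
  by case: (u) u0 inb => // y s _ /(_ _ (mem_head _ _))/andP[].
have um'u : uniq (m' :: u) by case/andP: uamu.
have umv : uniq (m :: v) by case/andP: uamv.
have szuv : size u = size v by rewrite -(perm_size pl) size_map size_pairmap.
have pmu : perm_eq (m' :: u) (m :: v).
  have [|_ E] := uniq_min_size um'u sub; first by rewrite /= szuv.
  exact: uniq_perm.
(* Both are the greatest element of the same set of vertices. *)
have Em : m' = m.
  apply/eqP; apply: contraT => m'm.
  have := sub m' (mem_head _ _); rewrite inE (negPf m'm) /= => m'v.
  have : m \in m' :: u by rewrite (perm_mem pmu) mem_head.
  rewrite inE eq_sym (negPf m'm) /= => mu.
  case/and3P: amu => _ /allP/(_ _ mu) mm' _; case/and3P: amv => _ /allP/(_ _ m'v) m'm2 _.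
  by have := ltn_trans mm' m'm2; rewrite ltnn.
move: um'u pl pmu sub; rewrite {}Em => umu pl pmu sub; congr (_ :: _).
(* Two lists with the same elements, both strictly increasing in position, coincide. *)
apply: (@irr_sorted_eq _ (pos_lt m v)).
- by move=> j i k; apply: ltn_trans.
- by move=> i; rewrite /= ltnn.
- apply: later_path => //; rewrite /= (perm_uniq pl) (perm_mem pl).
  exact: umv.
- exact: path_pos.
- exact: perm_mem.
Qed.

End Hits.

(** * Separating functionals and linear independence *)

Section Separation.
Variable n : nat.
Implicit Types (c d : seq 'I_n) (f g : V n).
Local Opaque mul mono genv omega dgen.

Definition cycle_element (t : bool) c : V n := if t then LC c else LC' c.

Lemma test_coef_linear t a m v : linear (test_coef t a m v : V n -> rat^o).
Proof. by move=> k f g; rewrite /test_coef test_mapD test_mapZ !ffunE. Qed.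

Lemma test_coef_cycle_element t t' a m v c : apex a m v -> uniq c -> (2 <= size c)%N ->
  (test_coef t a m v (cycle_element t' c) != 0) = (t == t') && hits a m v c.
Proof.
move=> amv uc sc; rewrite /cycle_element.
case: t' => /=; rewrite /LC /LC' LgenE; [|exact: xg_odd1| |exact: yg_odd1];
  case: t => /=.
- apply: test_coef_cycle => // i; first exact: xg_odd1.
  by rewrite test_map_xg.
- by rewrite test_coef_zero ?eqxx // => i; rewrite test_map_xg.
- by rewrite test_coef_zero ?eqxx // => i; rewrite test_map_yg.
- apply: test_coef_cycle => // i; first exact: yg_odd1.
  by rewrite test_map_yg.
Qed.

Lemma standard_separation c t : circuit c -> standard c -> exists phi : V n -> rat^o,
  [/\ linear phi, forall f, f \in Iideal n -> phi f = 0, phi (cycle_element t c) != 0 &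
     forall t' d, circuit d -> standard d -> phi (cycle_element t' d) != 0 ->
       t' = t /\ edgeset d = edgeset c].
Proof.
move=> cc sc; have [a [m [v [amv szc pc]]]] := standard_apex cc sc.
have circP d : circuit d -> uniq d /\ (2 <= size d)%N by case/andP => ud /ltnW.
have [uc sc2] := circP c cc.
exists (test_coef t a m v); split; first exact: test_coef_linear.
- by move=> f; apply: test_coef_Iideal.
- rewrite test_coef_cycle_element // eqxx (hits_uedge _ _ _ _ _ _ _ pc) ?apex_uniq //.
  exact: hits_refl.
move=> t' d cd sd; have [ud sd2] := circP d cd.
rewrite test_coef_cycle_element // => /andP[/eqP-> hd]; split=> //.
have [a' [m' [u [amu szd pd]]]] := standard_apex cd sd.
rewrite (hits_uedge _ _ _ _ _ _ _ pd) ?apex_uniq // in hd.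
have u0 : u != [::].
  by apply: contraTneq cd => u0; rewrite /circuit -szd u0 andbF.
rewrite (hits_apex_inj amv amu u0 hd) in pd.
have pdc : perm_eq (map (@uedge n) (cedges d)) (map (@uedge n) (cedges c)).
  by rewrite (perm_trans pd) // perm_sym.
have mem_edgeset b e : (e \in edgeset b) = (e \in map (@uedge n) (cedges b)).
  by apply/imsetP/mapP => -[x xb ->]; exists x.
by apply/setP => e; rewrite !mem_edgeset (perm_mem pdc).
Qed.

(** Turns the count in [std_reps] into uniqueness of the index that represents a given cycle. *)
Lemma count_inj (T : Type) (P : pred T) (s : seq T) x0 i j : count P s = 1%N ->
  (i < size s)%N -> (j < size s)%N -> P (nth x0 s i) -> P (nth x0 s j) -> i = j.
Proof.
elim: s i j => // x s IH [|i] [|j] //=; rewrite ?ltnS.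
- move=> cnt _ js Px Pj; have : has P s by apply/(has_nthP x0); exists j.
  by rewrite has_count; move: cnt; rewrite Px add1n => -[->].
- move=> cnt js _ Pj Px; have : has P s by apply/(has_nthP x0); exists i.
  by rewrite has_count; move: cnt; rewrite Px add1n => -[->].
move=> cnt si sj Pi Pj; congr _.+1; apply: IH => //.
have : has P s by apply/(has_nthP x0); exists i.
by rewrite has_count; case: (P x) cnt; rewrite ?add0n // add1n => -[->].
Qed.

Local Opaque LC LC'.

Lemma cycle_elements_free (cs : seq (seq 'I_n)) : std_reps cs ->
  forall a b : 'I_(size cs) -> rat,
    \sum_(i < size cs) (a i *: LC (nth [::] cs i) + b i *: LC' (nth [::] cs i)) \in Iideal n ->
  forall i, a i = 0 /\ b i = 0.
Proof.
move=> [csP cs1] a b sumI i; set c := nth [::] cs.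
have csi (j : 'I_(size cs)) : circuit (c j) /\ standard (c j).
  by apply/andP; apply: csP; apply: mem_nth.
have neq0 t : (if t then a i else b i) = 0.
  have [phi [phiL phiI phic phid]] := standard_separation t (csi i).1 (csi i).2.
  have phiD f g : phi (f + g) = phi f + phi g by rewrite -[f]scale1r phiL !scale1r.
  have phi0 : phi 0 = 0 by rewrite phiI ?mem0v.
  have phiZ k f : phi (k *: f) = k * phi f by rewrite -[k *: f]addr0 phiL phi0 addr0.
  have phi2 k l f g : phi (k *: f + l *: g) = k * phi f + l * phi g.
    by rewrite phiD !phiZ.
  have phi0' t' j : (t' == t) && (j == i) = false -> phi (cycle_element t' (c j)) = 0.
    move=> ne; apply/eqP; apply: contraFT ne => /(phid _ _ (csi j).1 (csi j).2)[-> Eji].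
    rewrite eqxx; apply/eqP/val_inj.
    apply: (count_inj (x0 := [::]) (cs1 _ (csi i).1 (csi i).2)) => //=.
      exact: introT eqP Eji.
  (* The functional of the i-th cycle is applied to the relation; every summand with j different
     from i vanishes. *)
  have := phiI _ sumI; rewrite (big_morph phi phiD phi0) (bigD1 i) //= big1 => [|j ji]; last first.
    have jF t' : (t' == t) && (j == i) = false by rewrite (negPf ji) andbF.
    have e1 : phi (LC (c j)) = 0 := phi0' true j (jF true).
    have e2 : phi (LC' (c j)) = 0 := phi0' false j (jF false).
    apply: etrans (phi2 _ _ _ _) _.
    apply: etrans (congr2 (fun x y => a j * x + b j * y) e1 e2) _.
    by rewrite !mulr0 addr0.
  rewrite addr0 => /(etrans (esym (phi2 _ _ _ _))) sum0.
  have mul_eq0 (x : rat) y : y != 0 -> x * y = 0 -> x = 0.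
    by move=> y0 /eqP; rewrite mulf_eq0 (negPf y0) orbF => /eqP.
  move: phic phi0'; case: t {phid} => phic phi0'.
    have e2 : phi (LC' (c i)) = 0 := phi0' false i erefl.
    apply: mul_eq0 phic _; apply: etrans sum0; apply: esym.
    apply: etrans (congr1 (fun y => a i * phi (LC (c i)) + b i * y) e2) _.
    by rewrite mulr0 addr0.
  have e1 : phi (LC (c i)) = 0 := phi0' true i erefl.
  apply: mul_eq0 phic _; apply: etrans sum0; apply: esym.
  apply: etrans (congr1 (fun y => a i * y + b i * phi (LC' (c i))) e1) _.
  by rewrite mulr0 add0r.
by split; [apply: (neq0 true) | apply: (neq0 false)].
Qed.

End Separation.

(** * Counting and dimensions *)

Section Counting.
Variables (n k : nat).
Implicit Types (c : seq 'I_n) (B : {set 'I_n}).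

Definition decreasing B := sort (fun i j : 'I_n => (j <= i)%N) (enum B).

(** For k >= 1, one circuit in normal form for each standard cycle of length k + 2. Starting with
    the two greatest vertices fixes the orientation, so each order of the others gives a different
    cycle. *)
Definition apex_circuits : seq (seq 'I_n) :=
  [seq take 2 (decreasing B) ++ v
  | B <- enum [set B : {set 'I_n} | #|B| == k.+2], v <- permutations (drop 2 (decreasing B))].

Let decreasingP B : #|B| = k.+2 -> exists a m v,
  [/\ decreasing B = [:: a, m & v], size v = k & apex a m v].
Proof.
move=> cS; have szd : size (decreasing B) = k.+2 by rewrite size_sort -cardE.
have ud : uniq (decreasing B) by rewrite sort_uniq enum_uniq.
have : sorted (fun i j : 'I_n => (j <= i)%N) (decreasing B).
  by apply: sort_sorted => i j; apply: leq_total.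
have tr : transitive (fun i j : 'I_n => (j <= i)%N) by move=> j i l ij jl; apply: leq_trans jl ij.
case: (decreasing B) szd ud => [|a [|m v]] //= [szv] /and3P[aN mN uv] /andP[ma mv].
exists a, m, v; split=> //; apply/and3P; split=> //.
  rewrite ltn_neqAle ma andbT; apply: contraNneq aN => /val_inj ->; exact: mem_head.
move: (order_path_min tr mv) => /allP vm; apply/allP => i iv.
rewrite ltn_neqAle vm // andbT; apply: contraNneq mN => /val_inj <- //.
Qed.

Lemma apex_circuitsP c : c \in apex_circuits ->
  exists a m v, [/\ c = [:: a, m & v], size v = k & apex a m v].
Proof.
case/allpairsPdep => B [v [BB pv ->]]; move: BB; rewrite mem_enum inE => /eqP cS.
have [a [m [w [Ed szw amw]]]] := decreasingP cS.
move: pv; rewrite Ed /= drop0 mem_permutations take0 => pv.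
exists a, m, v; split=> //; first by rewrite (perm_size pv).
case/and3P: amw => ma wm uw; apply/and3P; split=> //; last by rewrite (perm_uniq pv).
by rewrite (perm_all _ pv).
Qed.

Lemma apex_circuits_uniq : uniq apex_circuits.
Proof.
apply: allpairs_uniq_dep => [|B _|]; first exact: enum_uniq; first exact: permutations_uniq.
move=> _ _ /allpairsPdep[B [v [BB pv ->]]] /allpairsPdep[B' [v' [BB' pv' ->]]] /= E.
(* The vertex set of the list recovers [B], and then its tail recovers [v]. *)
have setE T w : w \in permutations (drop 2 (decreasing T)) ->
    [set i in take 2 (decreasing T) ++ w] = T.
  rewrite mem_permutations => pw; apply/setP => i.
  rewrite inE (perm_mem (_ : perm_eq _ (decreasing T))) ?mem_sort ?mem_enum //.
  by rewrite -[X in perm_eq _ X](cat_take_drop 2) perm_cat2l.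
have ES : B = B' by rewrite -(setE _ _ pv) E setE.
by move: pv' E; rewrite -ES => _ /eqP; rewrite eqseq_cat // => /andP[_ /eqP ->].
Qed.

Lemma size_apex_circuits : size apex_circuits = ('C(n, k.+2) * k`!)%N.
Proof.
rewrite size_allpairs_dep.
transitivity (sumn [seq k`! | _ <- enum [set B : {set 'I_n} | #|B| == k.+2]]).
  congr sumn; apply/eq_in_map => B; rewrite mem_enum inE => /eqP.
  move=> /decreasingP[a [m [v [Ed szv amv]]]].
  by rewrite size_permutations Ed /= drop0 ?szv //; case/and3P: amv.
by rewrite sumnE big_map big_const_seq count_predT iter_addn_0 -cardE card_draws card_ord mulnC.
Qed.

End Counting.

(** The functionals together form a linear map from [Z] onto K^J that kills [B]: its matrix on the
    [u j] is diagonal and invertible. Rank-nullity gives the bound. *)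
Lemma dimv_separated (K : fieldType) (W : vectType K) (Z B : {vspace W}) (J : finType)
    (u : J -> W) (phi : J -> W -> K^o) :
  (B <= Z)%VS -> (forall j, u j \in Z) -> (forall j, linear (phi j)) ->
  (forall j f, f \in B -> phi j f = 0) -> (forall i j, (phi i (u j) != 0) = (i == j)) ->
  (\dim B + #|J| <= \dim Z)%N.
Proof.
move=> BZ uZ phiL phiB phiu.
pose Phi f : 'rV[K]_#|J| := \row_i phi (enum_val i) f.
have PhiL : linear Phi by move=> k f g; apply/rowP => i; rewrite !mxE phiL.
pose PhiS := GRing.isLinear.Build K W 'rV[K]_#|J| _ Phi PhiL.
pose PhiF : {linear W -> 'rV[K]_#|J|} := HB.pack Phi PhiS.
have PhiE f : linfun PhiF f = Phi f by rewrite lfunE.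
rewrite -(limg_ker_dim (linfun PhiF) Z) leq_add //.
  apply: dimvS; apply/subvP => f fB; rewrite memv_cap (subvP BZ) // memv_ker PhiE.
  by apply/eqP/rowP => i; rewrite !mxE phiB.
have full : (fullv <= linfun PhiF @: Z)%VS.
  apply/subvP => r _; pose f := \sum_j (r 0 (enum_rank j) / phi j (u j)) *: u j.
  suff -> : r = linfun PhiF f by apply: memv_img; apply: rpred_sum => j _; apply: rpredZ.
  rewrite linear_sum; apply/rowP => i; rewrite summxE (bigD1 (enum_val i)) //= big1 ?addr0.
    rewrite linearZ /= PhiE !mxE enum_valK divfK // phiu //.
  move=> j ji; rewrite linearZ /= PhiE !mxE.
  have := phiu (enum_val i) j; rewrite [enum_val i == j]eq_sym (negPf ji) => /negbFE/eqP ->.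
  by rewrite mulr0.
by have := dimvS full; rewrite dimvf /dim /= mul1n.
Qed.

(** * The lower bound for the third page *)

Section LowerBound.
Variable n : nat.
Local Opaque mul mono genv omega dgen LC LC'.

Lemma E3dim_lower_bound q : (1 <= q)%N -> (2 * 'C(n, q + 2) * q`! <= E3dim n 1 q)%N.
Proof.
(* For p = 1 no differential comes in, so the subtracted space is the bidegree part of the ideal. *)
move=> q1; rewrite addn2 /E3dim /= limg0 addv0.
set cs := apex_circuits n q.
have csP (i : 'I_(size cs)) := apex_circuitsP (mem_nth [::] (ltn_ord i) : nth [::] cs i \in cs).
set B := (comp n 1 q :&: Iideal n)%VS.
set Z := (_ :&: _)%VS.
suff : (\dim B + #|{: bool * 'I_(size cs)}| <= \dim Z)%N.
  rewrite card_prod card_bool card_ord size_apex_circuits mulnA => H.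
  by rewrite leq_subRL // (leq_trans _ H) // leq_addr.
pose u (j : bool * 'I_(size cs)) : V n := cycle_element j.1 (nth [::] cs j.2).
pose phi (j : bool * 'I_(size cs)) : V n -> rat^o :=
  if nth [::] cs j.2 is [:: a, m & v] then test_coef j.1 a m v else fun=> 0.
apply: (@dimv_separated _ _ _ _ _ u phi).
- apply/subvP => f; rewrite !memv_cap => /andP[-> fI] /=.
  by rewrite -memv_preim; exact: diff_Iideal.
- move=> [t i]; rewrite /u /Z memv_cap -memv_preim /=.
  have [a [m [v [E szv _]]]] := csP i.
  apply/andP; split.
    have szc : (size (nth [::] cs i)).-2 = q by rewrite E /= szv.
    have := LC_comp (nth [::] cs i); have := LC'_comp (nth [::] cs i); rewrite szc => h' h.
    by case: (t); [exact: h | exact: h'].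
  by case: (t); [exact: diff_LC | exact: diff_LC'].
- move=> [t i] /=; rewrite /phi /=; have [a [m [v [-> _ _]]]] := csP i.
  exact: test_coef_linear.
- move=> [t i] f; rewrite memv_cap => /andP[_ fI]; rewrite /phi /=.
  have [a [m [v [-> _ amv]]]] := csP i; exact: test_coef_Iideal.
move=> [t i] [t' i']; rewrite /phi /u /=.
have [a [m [v [E szv amv]]]] := csP i; have [a' [m' [w [E' szw amw]]]] := csP i'.
rewrite E E' test_coef_cycle_element ?apex_uniq // xpair_eqE; congr andb.
apply/idP/eqP => [h|Ei]; last first.
  by move: E'; rewrite -Ei E => <-; apply: hits_refl.
apply: val_inj; apply/eqP; rewrite -(nth_uniq [::] (ltn_ord i) (ltn_ord i') (apex_circuits_uniq n q)).
rewrite -/cs E E' eq_sym; apply/eqP; apply: hits_apex_inj h => //.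
(* Since q >= 1 the tail is nonempty, as [hits_apex_inj] requires. *)
by apply: contraTneq q1 => w0; rewrite -szw w0.
Qed.

End LowerBound.

Theorem theorem2p13 (n : nat) : (3 <= n)%N ->
  (forall cs : seq (seq 'I_n), std_reps cs ->
     forall a b : 'I_(size cs) -> rat,
       (\sum_(i < size cs) (a i *: LC (nth [::] cs i) + b i *: LC' (nth [::] cs i)))
         \in Iideal n ->
       forall i, a i = 0 /\ b i = 0) /\
  (forall q : nat, (1 <= q)%N -> (2 * 'C(n, q + 2) * q`! <= E3dim n 1 q)%N).
Proof.
by move=> _; split; [exact: cycle_elements_free | exact: E3dim_lower_bound].
Qed.
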